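(* Let $n\ge 1$, let $\|\cdot\|$ be a norm on $\mathbb{R}^n$, let $\varepsilon>0$, $\Delta>0$, and let $\Phi:\mathbb{R}^n\to[0,\infty]$ be of the form $\Phi(x)=\varphi(\|x\|)$ for some nondecreasing function $\varphi:[0,\infty)\to[0,\infty]$. Then $$\inf_{\mu\in\mathcal{M}_n(\Delta,\varepsilon)}\int_{\mathbb{R}^n}\Phi(x)\,\mu(dx)=\inf_{\gamma\in[0,1]}\int_{\mathbb{R}^n}\Phi(x)f_\gamma(x)\,dx .$$ Moreover, the infimum on the right-hand side is attained: there exists $\gamma^\star\in[0,1]$ such that $$\inf_{\gamma\in[0,1]}\int_{\mathbb{R}^n}\Phi(x)f_\gamma(x)\,dx=\int_{\mathbb{R}^n}\Phi(x)f_{\gamma^\star}(x)\,dx,$$ and the staircase mechanism with parameter $\gamma^\star$ is optimal among all additive $\varepsilon$-differentially private mechanisms, i.e. the probability measure with density $f_{\gamma^\star}$ belongs to $\mathcal{M}_n(\Delta,\varepsilon)$ and attains the infimum on the left-hand side of the first display.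
   Context: $\mathcal{M}_n(\Delta,\varepsilon)$ is the set of Borel probability measures $\mu$ on $\mathbb{R}^n$ that are absolutely continuous with respect to Lebesgue measure and have a (version of the) density $f$ satisfying $f(x)\le e^{\varepsilon}f(y)$ for all $x,y\in\mathbb{R}^n$ with $\|x-y\|\le\Delta$. These are exactly the noise laws of additive $\varepsilon$-differentially private mechanisms $D\mapsto q(D)+X$ for queries $q$ with $\|\cdot\|$-sensitivity $\Delta$. For $\gamma\in[0,1]$ the staircase density $f_\gamma$ is $$f_\gamma(x)=a(\gamma)\sum_{k=0}^\infty e^{-k\varepsilon}\,\mathbf{1}_{[(k-1+\gamma)\Delta,(k+\gamma)\Delta)}(\|x\|),$$ where $a(\gamma)>0$ is the constant making $f_\gamma$ a probability density on $\mathbb{R}^n$. (For $\gamma=0$ the term $k=0$ does not contribute, and $f_0=f_1$.) The staircase mechanism with parameter $\gamma$ adds to $q(D)$ a noise vector $X_\gamma$ with density $f_\gamma$. Integrals of $\Phi$ take values in $[0,\infty]$. *)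

(* Defs.v *)
From HB Require Import structures.
From mathcomp Require Import all_boot all_order all_algebra.
From mathcomp Require Import all_classical all_reals all_analysis.

Set Implicit Arguments.
Unset Strict Implicit.
Unset Printing Implicit Defensive.
Import Order.TTheory GRing.Theory Num.Theory.
Import numFieldNormedType.Exports.

Local Open Scope classical_set_scope.
Local Open Scope ring_scope.

(* Points of R^n are row vectors 'rV[R]_n. The measurable sets of 'M[R]_(m, n)
   are the Borel sets, i.e. the sigma-algebra generated by the open sets of the
   usual topology. *)
Section borel_matrix.
Context {R : realType} {m n : nat}.

Definition borel_mx_display : measure_display :=
  sigma_display (@open 'M[R]_(m, n)).

HB.instance Definition _ := @isMeasurable.Build borel_mx_display
  'M[R]_(m, n) <<s @open 'M[R]_(m, n) >>
  (@sigma_algebra0 _ setT _) (@sigma_algebraC _ _) (@sigma_algebra_bigcup _ _ _).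

End borel_matrix.

Section measurable_row.
Context {R : realType}.

Definition rat_box n (q : 'rV[rat]_n * 'rV[rat]_n) : set 'rV[R]_n :=
  [set x | forall j, x ord0 j \in `]ratr (q.1 ord0 j), ratr (q.2 ord0 j)[].

Lemma open_rat_box n (U : set 'rV[R]_n) : open U ->
  U = \bigcup_(q in [set q | rat_box q `<=` U]) rat_box q.
Proof.
move=> oU; apply/seteqP; split=> [x Ux|x [q /= qU]]; last exact: qU.
have rat_below (t e : R) : 0 < e -> exists q : rat, ratr q \in `]t - e, t[.
  move=> e0; have /rat_in_itvoo[q tq] : t - e < t by rewrite ltrBlDr ltrDl.
  by exists q.
have rat_above (t e : R) : 0 < e -> exists q : rat, ratr q \in `]t, t + e[.
  move=> e0; have /rat_in_itvoo[q tq] : t < t + e by rewrite ltrDl.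
  by exists q.
have /nbhs_ballP[e /= e0 xeU] : nbhs x U by exact: open_nbhs_nbhs.
have [a aP] := @boolp.choice 'I_n rat
    (fun j q => ratr q \in `]x ord0 j - e, x ord0 j[)
    (fun j => rat_below (x ord0 j) e e0).
have [b bP] := @boolp.choice 'I_n rat
    (fun j q => ratr q \in `]x ord0 j, x ord0 j + e[)
    (fun j => rat_above (x ord0 j) e e0).
exists (\row_j a j, \row_j b j) => /=.
  move=> y /= yab; apply: xeU; split => // i j; rewrite ord1.
  have := aP j; have := bP j; have := yab j.
  rewrite !mxE !in_itv /= => /andP[ay yb] /andP[_ bx] /andP[ax _].
  rewrite /ball /= ltr_distlC; apply/andP; split.
    exact: lt_trans ay.
  exact: lt_trans bx.
move=> j; have := aP j; have := bP j.
by rewrite !mxE !in_itv /= => /andP[-> _] /andP[_ ->].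
Qed.

Lemma measurable_fun_rowP d (T : measurableType d) n (f : T -> 'rV[R]_n) :
  (forall j, measurable_fun [set: T] (fun x => f x ord0 j)) ->
  measurable_fun [set: T] f.
Proof.
move=> mf; apply: (measurability (@open 'rV[R]_n)) => //.
move=> _ [U oU <-]; rewrite setTI (open_rat_box oU) preimage_bigcup.
rewrite bigcup_mkcond; apply: countable_bigcupT_measurable => // q.
case: ifPn => // _.
rewrite (_ : _ @^-1` _ = \bigcap_(j in [set: 'I_n])
    ((fun x => f x ord0 j) @^-1`
       `]ratr (q.1 ord0 j), ratr (q.2 ord0 j)[%classic)).
  apply: fin_bigcap_measurable => // j _.
  rewrite -[X in measurable X]setTI; apply: mf => //.
by apply/seteqP; split=> x /= H j => [_|]; apply: H.
Qed.

Lemma measurable_coord n (j : 'I_n) :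
  measurable_fun [set: 'rV[R]_n] (fun x => x ord0 j).
Proof.
apply: (measurability _ (measurable_realfun.RGenOpens.measurableE R)) => //.
move=> _ [_ [a [b ->]] <-]; rewrite setTI.
apply: sub_sigma_algebra; apply: open_comp => //.
  by move=> x _; exact: coord_continuous.
Qed.

End measurable_row.

Section lebesgue_rV.
Context {R : realType}.

Definition rV_cons n (p : 'rV[R]_n * measurableTypeR R) : 'rV[R]_n.+1 :=
  \row_i oapp (fun j => p.1 ord0 j) p.2 (unlift ord0 i).

Lemma measurable_rV_cons n : measurable_fun setT (@rV_cons n).
Proof.
apply: measurable_fun_rowP => i; rewrite /rV_cons.
under eq_fun do rewrite mxE.
case: (unliftP ord0 i) => [j _|_] /=.
  exact: measurableT_comp (measurable_coord j) measurable_fst.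
exact: measurable_snd.
Qed.

(* Lebesgue measure on R^n, built as the n-fold product of Lebesgue measure on
   R; it is characterized by lebesgue_rV_box below. *)
Fixpoint lebesgue_rV n : set 'rV[R]_n -> \bar R :=
  match n with
  | 0 => \d_(0 : 'rV[R]_0)
  | n'.+1 => pushforward (@lebesgue_rV n' \x lebesgue_measure)%E (@rV_cons n')
  end.
Arguments lebesgue_rV : clear implicits.

Lemma lebesgue_rV_is_measure n :
  exists mu : {measure set 'rV[R]_n -> \bar R}, lebesgue_rV n = mu :> (_ -> _).
Proof.
elim: n => [|n [mu muE]] /=.
  by exists (dirac (0 : 'rV[R]_0)).
rewrite muE.
unshelve eexists.
  apply: [the {measure set _ -> \bar R} of
    pushforward (mu \x lebesgue_measure)%E (@rV_cons n)].
  exact: measurable_rV_cons.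
by [].
Qed.

Let lebesgue_rV0 n : lebesgue_rV n set0 = 0%E.
Proof. by have [mu ->] := lebesgue_rV_is_measure n; exact: measure0. Qed.

Let lebesgue_rV_ge0 n A : (0 <= lebesgue_rV n A)%E.
Proof. by have [mu ->] := lebesgue_rV_is_measure n; exact: measure_ge0. Qed.

Let lebesgue_rV_sigma_additive n : semi_sigma_additive (lebesgue_rV n).
Proof.
by have [mu ->] := lebesgue_rV_is_measure n; exact: measure_semi_sigma_additive.
Qed.

HB.instance Definition _ n := isMeasure.Build _ _ _ (lebesgue_rV n)
  (@lebesgue_rV0 n) (@lebesgue_rV_ge0 n) (@lebesgue_rV_sigma_additive n).

Lemma measurable_box n (A : 'I_n -> set (measurableTypeR R)) :
  (forall i, measurable (A i)) ->
  measurable [set x : 'rV[R]_n | forall i, A i (x ord0 i)].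
Proof.
move=> mA.
rewrite (_ : mkset _ =
    \bigcap_(i in [set: 'I_n]) ((fun x : 'rV[R]_n => x ord0 i) @^-1` A i)).
  apply: fin_bigcap_measurable => // i _.
  by rewrite -[X in measurable X]setTI; apply: measurable_coord => //; exact: mA.
by apply/seteqP; split=> x /= H i => [_|]; apply: H.
Qed.

Lemma lebesgue_rV_box n (A : 'I_n -> set (measurableTypeR R)) :
  (forall i, measurable (A i)) ->
  lebesgue_rV n [set x | forall i, A i (x ord0 i)] =
  (\prod_(i < n) lebesgue_measure (A i))%E.
Proof.
elim: n A => [A _|n IHn A mA] /=.
  rewrite big_ord0 diracE mem_set//=.
  by case.
rewrite big_ord_recl -IHn// muleC -product_measure1E//; last first.
  by apply: (measurable_box (A := fun i => A (lift ord0 i))) => i; exact: mA.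
rewrite /pushforward; congr (_ _).
apply/seteqP; split=> -[x t] /=.
  move=> xtA; split=> [i|].
    by have := xtA (lift ord0 i); rewrite mxE liftK.
  by have := xtA ord0; rewrite mxE unlift_none.
move=> [xA tA] i; rewrite mxE.
by case: (unliftP ord0 i) => [j ->|->] /=.
Qed.

End lebesgue_rV.
Arguments lebesgue_rV {R} n.

Section staircase.
Context {R : realType} {n : nat}.
Implicit Types (N : 'rV[R]_n -> R) (f : 'rV[R]_n -> R).
Implicit Types (epsilon Delta gamma : R).

(* A predicate because `|x| on 'rV[R]_n always denotes the sup norm. *)
Definition is_norm N : Prop :=
  [/\ forall x y, N (x + y) <= N x + N y,
      forall (a : R) x, N (a *: x) = `|a| * N x &
      forall x, N x = 0 -> x = 0].

Definition has_density (mu : probability 'rV[R]_n R) f : Prop :=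
  [/\ measurable_fun setT f,
      forall x, 0 <= f x &
      forall A, measurable A ->
        mu A = (\int[lebesgue_rV n]_(x in A) (f x)%:E)%E].

Definition dp_noise N Delta epsilon : set (probability 'rV[R]_n R) :=
  [set mu : probability 'rV[R]_n R | mu `<< lebesgue_rV n /\
    exists2 f, has_density mu f &
      forall x y, N (x - y) <= Delta -> f x <= expR epsilon * f y].

(* At every point at most one term of the series is nonzero, since 0 < Delta. *)
Definition staircase_profile N Delta epsilon gamma (x : 'rV[R]_n) : R :=
  limn (series (fun k : nat => expR (- (k%:R * epsilon)) *
    \1_(`[(k%:R - 1 + gamma) * Delta, (k%:R + gamma) * Delta[%classic) (N x))).

(* a(gamma), the normalising constant of the profile. *)
Definition staircase_const N Delta epsilon gamma : R :=
  (\int[lebesgue_rV n]_x staircase_profile N Delta epsilon gamma x)^-1.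

Definition staircase_density N Delta epsilon gamma (x : 'rV[R]_n) : R :=
  staircase_const N Delta epsilon gamma *
  staircase_profile N Delta epsilon gamma x.

End staircase.

(* Main.v *)
(* Write M for a number below the cost of every staircase. By polar
   coordinates it suffices to bound the cost of a density f along each ray from
   the origin, that is, to show
     \int phi(r) g(r) r^(n-1) dr >= M \int g(r) r^(n-1) dr
   for a positive g on the line with g(r) <= e^epsilon g(r') whenever
   |r - r'| <= Delta. Such a g is an average over t of its roundings
   e^(-epsilon k(r)), with k = floor((ln t - ln g) / epsilon), and k varies by
   at most 1 over distances at most Delta. If phi crosses M at r0, there is a
   staircase with jumps at rho + Delta Z that lies above the rounded function
   before r0 and below it after r0; since (phi - M) changes sign at r0 only, the
   rounded function costs at least as much as this staircase, whose cost is at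
   least M. The optimal gamma exists because the cost of f_gamma is lower
   semicontinuous in gamma. *)

Require Import Defs.
From HB Require Import structures.
From mathcomp Require Import all_boot all_order all_algebra.
From mathcomp Require Import all_classical all_reals all_analysis.
From mathcomp Require Import measurable_realfun ring lra.

Set Implicit Arguments.
Unset Strict Implicit.
Unset Printing Implicit Defensive.
Import Order.TTheory GRing.Theory Num.Theory.
Import numFieldNormedType.Exports.

Local Open Scope classical_set_scope.
Local Open Scope ring_scope.

(** * Scaling and iterated integration for Lebesgue measure *)

(** The inequality on a ray, cost at least M times mass, is linear in the density and involves no
    normalisation. It therefore survives both averagings, over the rounding levels t and over the
    directions, although neither the restriction of f to a ray nor its roundings are probability
    densities. Since [phi] may be infinite and a rounded function is not assumed to have finite
    mass, the comparison with a staircase is written without subtraction, and only the finite term M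
    times the staircase mass is ever cancelled. Keeping M strictly below all staircase costs
    excludes that [phi] stays below M everywhere, so either [phi] is at least M throughout or a
    crossing r0 exists. Taking the logarithm of g is legitimate because a private density that
    vanishes at one point vanishes everywhere. *)

Section integral_setT.
Context d (T : measurableType d) {R : realType}.
Variable mu : {measure set T -> \bar R}.
Local Open Scope ereal_scope.

Lemma ge0_integralTZl (k : R) (f : T -> \bar R) :
  measurable_fun setT f -> (forall x, 0 <= f x) -> (0 <= k)%R ->
  \int[mu]_x (k%:E * f x) = k%:E * \int[mu]_x f x.
Proof. by move=> mf f0 k0; rewrite ge0_integralZl_EFin. Qed.

Lemma ge0_integralTZr (k : \bar R) (f : T -> \bar R) :
  measurable_fun setT f -> (forall x, 0 <= f x) -> 0 <= k ->
  \int[mu]_x (f x * k) = (\int[mu]_x f x) * k.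
Proof. by move=> mf f0 k0; rewrite ge0_integralZr. Qed.

Lemma ge0_integralTD (f g : T -> \bar R) :
  measurable_fun setT f -> measurable_fun setT g ->
  (forall x, 0 <= f x) -> (forall x, 0 <= g x) ->
  \int[mu]_x (f x + g x) = \int[mu]_x f x + \int[mu]_x g x.
Proof. by move=> mf mg f0 g0; rewrite ge0_integralD. Qed.

Lemma ge0_le_integralT (f g : T -> \bar R) :
  measurable_fun setT f -> measurable_fun setT g ->
  (forall x, 0 <= f x) -> (forall x, f x <= g x) ->
  \int[mu]_x f x <= \int[mu]_x g x.
Proof. by move=> mf mg f0 fg; apply: ge0_le_integral. Qed.

End integral_setT.

Section lebesgue_scale.
Context {R : realType}.
Local Open Scope ereal_scope.
Notation leb := (@lebesgue_measure R).

(** Uniqueness of Lebesgue measure: [a] times the pushforward under multiplication by [a] gives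
    every interval ]x, y] its length. *)
Lemma lebesgue_measure_scale (a : R) (A : set (measurableTypeR R)) :
  (0 < a)%R -> measurable A -> leb ( *%R a @^-1` A) = a^-1%:E * leb A.
Proof.
move=> a0 mA.
pose f : measurableTypeR R -> measurableTypeR R := *%R a.
have mf : measurable_fun [set: measurableTypeR R] f by exact: mulrl_measurable.
have fA B : measurable B -> measurable (f @^-1` B).
  by move=> mB; rewrite -[X in measurable X]setTI; exact: mf.
have -> : leb A = a%:E * leb (f @^-1` A).
  apply: (@lebesgue_measure_unique R
    (mscale (NngNum (ltW a0)) (measure_function_pushforward__canonical__measure_function_Measure leb mf))) => //.
  move=> _ [[x y]] _ <- /=; rewrite /mscale/= /pushforward.
  rewrite (_ : f @^-1` _ = `](x / a)%R, (y / a)%R]%classic).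
    rewrite /= !lebesgue_measure_itv/= !lte_fin ltr_pM2r ?invr_gt0//.
    case: ifPn => xy; last by rewrite mule0.
    by rewrite -EFinB -EFinM -mulrBl mulrCA divff ?mulr1 ?gt_eqF.
  apply/seteqP; split=> t /=; rewrite !in_itv/= /f.
    by rewrite ltr_pdivrMr// ler_pdivlMr// ![(t * a)%R]mulrC.
  by rewrite ltr_pdivrMr// ler_pdivlMr// ![(t * a)%R]mulrC.
by rewrite muleA -EFinM mulVf ?mul1e// gt_eqF.
Qed.

Lemma integral_scale (a : R) (f : R -> \bar R) : (0 < a)%R ->
  measurable_fun [set: R] f -> (forall x, 0 <= f x) ->
  \int[leb]_x f (a * x)%R = a^-1%:E * \int[leb]_x f x.
Proof.
move=> a0 mf f0; have a0' : (0 <= a^-1)%R by rewrite invr_ge0 ltW.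
have ms : measurable_fun [set: measurableTypeR R]
    ( *%R a : measurableTypeR R -> measurableTypeR R).
  exact: mulrl_measurable.
transitivity (\int[pushforward leb ( *%R a : _ -> measurableTypeR R)]_x f x).
  by rewrite (ge0_integral_pushforward ms).
rewrite -(ge0_integral_mscale _ _ (NngNum a0'))//.
apply: (@eq_measure_integral _ _ _ _ (mscale (NngNum a0') leb)) => A mA _.
exact: lebesgue_measure_scale.
Qed.

End lebesgue_scale.

Section lebesgue_rV.
Context {R : realType}.
Local Open Scope ereal_scope.
Notation leb := (@lebesgue_measure R).

Lemma sigma_finite_lebesgue_rV n :
  sigma_finite [set: 'rV[R]_n] (lebesgue_rV n).
Proof.
exists (fun k => [set x : 'rV[R]_n | forall i,
    `[(- k%:R)%R, k%:R]%classic (x ord0 i)]).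
  apply/seteqP; split=> // x _.
  (* The sum of the rounded-up coordinates bounds each of them, so x lies in a cube of that size. *)
  exists (\sum_i (Num.truncn `|x ord0 i|%R).+1)%N => // i /=.
  rewrite in_itv/= -ler_norml (le_trans (ltW (truncnS_gt _)))// ler_nat.
  by rewrite [leqRHS](bigD1 i)//=; exact: leq_addr.
move=> k; split.
  by apply: (measurable_box (A := fun=> `[(- k%:R)%R, k%:R]%classic)).
rewrite (lebesgue_rV_box (A := fun=> `[(- k%:R)%R, k%:R]%classic))//.
have -> : leb `[(- k%:R)%R, k%:R]%classic = (k%:R - - k%:R)%:E.
  rewrite lebesgue_measure_itv/= lte_fin; case: ltgtP => //.
    by rewrite ltNge => /negP[]; rewrite lerNl (le_trans _ (ler0n _ _))// oppr_le0.
  by move=> kk; rewrite kk subrr.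
by rewrite prodEFin ltry.
Qed.

HB.instance Definition _ n := @Measure_isSigmaFinite.Build _ _ _ (@lebesgue_rV R n)
  (@sigma_finite_lebesgue_rV n).

Lemma integral_lebesgue_rV0 (h : 'rV[R]_0 -> \bar R) :
  measurable_fun setT h -> \int[lebesgue_rV 0]_x h x = h 0%R.
Proof.
move=> mh; transitivity (\int[\d_(0%R : 'rV[R]_0)]_x h x) => //.
by rewrite integral_dirac// diracT mul1e.
Qed.

Lemma integral_lebesgue_rVS n (h : 'rV[R]_n.+1 -> \bar R) :
  measurable_fun setT h -> (forall x, 0 <= h x) ->
  \int[lebesgue_rV n.+1]_x h x =
  \int[lebesgue_rV n]_p \int[leb]_t h (rV_cons (p, t)).
Proof.
move=> mh h0.
transitivity (\int[pushforward (lebesgue_rV n \x leb) (@rV_cons R n)]_x h x) => //.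
rewrite (ge0_integral_pushforward (@measurable_rV_cons R n))//.
rewrite preimage_setT.
have mcons : measurable_fun setT (h \o @rV_cons R n).
  by apply: measurableT_comp => //; exact: measurable_rV_cons.
pose m1 : {sigma_finite_measure set 'rV[R]_n -> \bar R} := @lebesgue_rV R n.
exact: (@fubini_tonelli1 _ _ _ _ _ m1 leb _ mcons (fun=> h0 _)).
Qed.

Lemma measurable_fun_rVZ d (T : measurableType d) n (k : T -> R)
    (f : T -> 'rV[R]_n) :
  measurable_fun setT k -> measurable_fun setT f ->
  measurable_fun setT (fun x => k x *: f x)%R.
Proof.
move=> mk mf; apply: measurable_fun_rowP => j.
under eq_fun do rewrite mxE.
apply: measurable_funM => //.
exact: (measurableT_comp (measurable_coord j) mf).
Qed.

Lemma integral_rV_scale n (a : R) (h : 'rV[R]_n -> \bar R) : (0 < a)%R ->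
  measurable_fun setT h -> (forall x, 0 <= h x) ->
  \int[lebesgue_rV n]_x h (a *: x)%R =
  (a ^- n)%:E * \int[lebesgue_rV n]_x h x.
Proof.
move=> a0; elim: n h => [|n IHn] h mh h0.
  rewrite !integral_lebesgue_rV0//; last first.
    apply: measurableT_comp => //.
    by apply: measurable_fun_rVZ => //; exact: measurable_cst.
  by rewrite scaler0 expr0 invr1 mul1e.
have mcons : measurable_fun setT (h \o @rV_cons R n).
  by apply: measurableT_comp => //; exact: measurable_rV_cons.
have mZ m : measurable_fun setT (fun x : 'rV[R]_m => a *: x)%R.
  by apply: measurable_fun_rVZ => //; exact: measurable_cst.
rewrite !integral_lebesgue_rVS//; last exact: measurableT_comp.
transitivity (\int[lebesgue_rV n]_p
    (a^-1%:E * \int[leb]_t h (rV_cons (a *: p, t)%R))).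
  apply: eq_integral => p _; rewrite -integral_scale//; last first.
    exact: (measurableT_comp mcons (measurable_pair1 _)).
  apply: eq_integral => t _; congr h.
  by apply/rowP => i; rewrite !mxE; case: (unlift ord0 i) => //= j; rewrite mxE.
have mF := measurable_fun_fubini_tonelli_F (m2 := leb) _ mcons (fun=> h0 _).
have F0 p : 0 <= fubini_F leb (h \o @rV_cons R n) p.
  by apply: integral_ge0 => t _; exact: h0.
have mFa : measurable_fun setT
  (fun p : 'rV_n => fubini_F leb (h \o @rV_cons R n) (a *: p)%R).
  exact: (measurableT_comp mF (mZ n)).
have a'0 : (0 <= a^-1)%R by rewrite invr_ge0 ltW.
apply: (etrans (ge0_integralTZl (lebesgue_rV n) mFa (fun p => F0 (a *: p)%R) a'0)).
by rewrite (IHn _ mF F0) muleA -EFinM exprS invfM.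
Qed.

End lebesgue_rV.

(** * Integer-valued functions with bounded steps *)

Section quantized.
Context {R : realType}.

Variable Delta : R.
Hypothesis Delta_gt0 : 0 < Delta.
Variable kappa : R -> int.
Hypothesis kappa_step :
  forall r s, `|r - s| <= Delta -> kappa r <= kappa s + 1.

(** Cut the segment from r to s into j + 1 equal parts: [m] is the end of the first one, at distance
    at most Delta from r. *)
Lemma kappa_chain (j : nat) r s :
  `|r - s| <= j%:R * Delta -> kappa r <= kappa s + j%:Z.
Proof.
elim: j r s => [|j IHj] r s.
  by rewrite mul0r normr_le0 subr_eq0 => /eqP ->; rewrite addr0.
move=> rs; pose m := r + (s - r) / j.+1%:R.
have j0 : (0 : R) < j.+1%:R by rewrite ltr0n.
have rm : kappa r <= kappa m + 1.
  apply: kappa_step; rewrite /m opprD addrA subrr add0r normrN normrM.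
  by rewrite normfV (gtr0_norm j0) ler_pdivrMr// distrC mulrC.
have ms : kappa m <= kappa s + j%:Z.
  apply: IHj; have -> : m - s = (r - s) * (j%:R / j.+1%:R).
    by rewrite /m -natr1; field; rewrite natr1 pnatr_eq0.
  rewrite normrM [X in _ * X]ger0_norm ?divr_ge0//.
  rewrite mulrA ler_pdivrMr//.
  by rewrite mulrC -mulrA ler_wpM2l// mulrC.
by rewrite (le_trans rm)// -addn1 PoszD addrA lerD2r.
Qed.

(* Every window of length [Delta] sees at most two consecutive values of
   [kappa]; [rho] is the last point of the window ending at [r0] at which the
   smaller one is taken. *)
Lemma staircase_crossing (r0 : R) : exists (rho : R) (p : int), forall r,
  (forall k : int, r != rho + k%:~R * Delta) ->
  (r < r0 -> p + Num.floor ((r - rho) / Delta) <= kappa r) /\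
  (r0 < r -> kappa r <= p + Num.floor ((r - rho) / Delta)).
Proof.
have D2 : 0 < Delta / 2 by rewrite divr_gt0.
have [q [c0 c0W qc0] qmin] : exists2 q, exists2 c, r0 - Delta < c < r0 & kappa c = q &
    forall r, r0 - Delta < r < r0 -> q <= kappa r.
  (* The points of the window are within Delta of its midpoint, so all values there are at least a -
     1: the minimum is a - 1 if that value is taken, and a otherwise. *)
  pose a := kappa (r0 - Delta / 2).
  have ha r : r0 - Delta < r < r0 -> a <= kappa r + 1.
    move=> /andP[r1 r2]; apply: kappa_step.
    by rewrite ler_norml; apply/andP; split; lra.
  have [[c cW ca]|H] := pselect (exists2 c, r0 - Delta < c < r0 & kappa c = a - 1).
    exists (a - 1); first by exists c.
    by move=> r /ha; rewrite lerBlDr.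
  exists a; first by exists (r0 - Delta / 2) => //; apply/andP; split; lra.
  move=> r rW; rewrite leNgt; apply/negP => ra; apply: H; exists r => //.
  apply/eqP; rewrite eq_le; apply/andP; split.
    by rewrite lerBrDr lezD1.
  by rewrite lerBlDr; exact: ha.
pose A := [set r | r0 - Delta < r < r0 /\ kappa r = q].
have Ac0 : A c0 by [].
have ubA : has_ubound A by exists r0 => r [/andP[_ /ltW]].
have supA : has_sup A by split=> //; exists c0.
pose rho := sup A.
have rho_r0 : rho <= r0 by apply: ge_sup; [exists c0|move=> r [/andP[_ /ltW]]].
have c0rho : c0 <= rho by exact: ub_le_sup.
have rho_gt : r0 - Delta < rho by move: c0W => /andP[+ _] => /lt_le_trans; apply.
(* The staircase equals q + 1 just after rho, because between rho and r0 the value q no longer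
   occurs. *)
exists rho, (q + 1) => r rk.
set j := Num.floor _.
have /andP[jr rj] : j%:~R <= (r - rho) / Delta < (j + 1)%:~R by exact: floor_itv.
have {}jr : rho + j%:~R * Delta < r.
  rewrite lt_neqAle eq_sym rk/=.
  by move: jr; rewrite ler_pdivlMr// lerBrDl.
have {}rj : r < rho + (j + 1)%:~R * Delta.
  by move: rj; rewrite ltr_pdivrMr// ltrBlDl.
rewrite intrD in rj.
split=> rr0.
  have j0 : j <= 0.
    rewrite leNgt; apply/negP => j0.
    have : (1 : int) <= j by [].
    rewrite -(ler_int R) => /(ler_wpM2r (ltW Delta_gt0)); rewrite mul1r; lra.
  have above c : rho < c < r0 -> q + 1 <= kappa c.
    move=> /andP[rc cr0]; rewrite lezD1 lt_neqAle qmin ?andbT; last first.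
      by rewrite cr0 (lt_trans rho_gt).
    apply/eqP => qc; have : c <= rho.
      by apply: ub_le_sup => //; split=> //; rewrite cr0 (lt_trans rho_gt).
    by rewrite leNgt rc.
  have [jE|jN0] := eqVneq j 0.
    by rewrite jE addr0; apply: above; rewrite rr0 andbT; rewrite jE in jr; lra.
  have [i jE] : exists i : nat, j = - i.+1%:Z.
    by exists `|j|%N.-1; rewrite prednK ?absz_gt0// lez0_abs// opprK.
  rewrite jE intrN -pmulrn mulNr in jr rj.
  (* If rho < r0, some point [c] of the window beyond rho is within (i + 1) Delta of r and has value
     at least q + 1. *)
  have [rhor0|] := ltP rho r0.
    pose c := (rho + Num.min r0 (r + i.+1%:R * Delta)) / 2.
    have rmin : rho < Num.min r0 (r + i.+1%:R * Delta).
      by rewrite lt_min rhor0/=; lra.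
    have [minr0 minr] : Num.min r0 (r + i.+1%:R * Delta) <= r0 /\ Num.min r0 (r + i.+1%:R * Delta) <= r + i.+1%:R * Delta.
      by split; rewrite ge_min lexx ?orbT.
    have iD : 1 * Delta <= i.+1%:R * Delta by rewrite ler_wpM2r ?(ltW Delta_gt0)// ler1n.
    have cW : rho < c < r0.
      by rewrite /c; apply/andP; split; lra.
    have cq := above c cW.
    rewrite jE lerBlDr (le_trans cq)//; apply: kappa_chain.
    by rewrite ler_norml /c; apply/andP; split; lra.
  (* If rho = r0 no point of the window lies beyond rho. Instead r + i Delta is in the window, with
     value at least q; saving one step makes up for the missing 1. *)
  move=> r0rho; have r0E : r0 = rho by apply/eqP; rewrite eq_le r0rho rho_r0.
  have : q <= kappa (r + i%:R * Delta).
    apply: qmin; rewrite -natr1 in jr rj.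
    by rewrite r0E; apply/andP; split; lra.
  move=> qi; have : kappa (r + i%:R * Delta) <= kappa r + i%:Z.
    apply: kappa_chain; rewrite addrAC subrr add0r ger0_norm//.
    by rewrite mulr_ge0// ltW.
  by move=> /(le_trans qi); rewrite jE lerBlDr -addn1 PoszD addrA lerD2r.
have j0 : 0 <= j.
  rewrite leNgt; apply/negP => j0.
  have : j + 1 <= 0 by rewrite lezD1.
  rewrite -(ler_int R) intrD => /(ler_wpM2r (ltW Delta_gt0)); rewrite mul0r; lra.
have jE : j = `|j|%N by rewrite gez0_abs.
rewrite jE -pmulrn in jr rj.
(* Since r < rho + (j + 1) Delta, the supremum provides a point [c] of value q at distance less than
   (j + 1) Delta before r. *)
have e0 : 0 < rho - (r - (`|j|.+1)%:R * Delta) by rewrite -natr1; lra.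
have [c [/andP[c1 c2] cq] crho] := sup_adherent e0 supA.
rewrite -/rho in crho.
have : kappa r <= kappa c + `|j|.+1%:Z.
  by apply: kappa_chain; rewrite ger0_norm; lra.
by rewrite cq -addn1 PoszD gez0_abs// addrA addrAC.
Qed.
End quantized.

(** * Rounding to a geometric grid *)

Section stair.
Context {R : realType}.
Variable epsilon : R.
Hypothesis epsilon_gt0 : 0 < epsilon.

(** Used in two ways: composed with an affine function of the norm it is a staircase profile, and at
    (ln t - ln y) / epsilon it is y / t rounded up to an integer power of [expR epsilon]. *)
Definition stair (x : R) : R := expR (- (Num.floor x)%:~R * epsilon).

Lemma stair_gt0 x : 0 < stair x. Proof. exact: expR_gt0. Qed.

Lemma stair_ge0 x : 0 <= stair x. Proof. exact: expR_ge0. Qed.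

Lemma le_stair x y : x <= y -> stair y <= stair x.
Proof.
move=> xy; rewrite /stair ler_expR; apply: ler_wpM2r; first exact: ltW.
rewrite lerN2 ler_int. exact: le_floor.
Qed.

Lemma stairDz x (k : int) : stair (x + k%:~R) = stair x * expR (- k%:~R * epsilon).
Proof.
by rewrite /stair floorDrz ?intr_int// intrKfloor -expRD intrD opprD mulrDl.
Qed.

Lemma stairD1 x : stair (x + 1) = stair x * expR (- epsilon).
Proof. by rewrite -[1]/(1%:~R) stairDz mulN1r. Qed.

Lemma measurable_stair : measurable_fun setT stair.
Proof. by apply: nonincreasing_measurable => // x y; exact: le_stair. Qed.

Local Open Scope ereal_scope.

(* Layer-cake with logarithmic levels: a positive number is the average of its
   roundings to the grids t * expR (- k * epsilon). *)
Lemma integral_stair_ln (y : R) : (0 < y)%R ->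
  \int[@lebesgue_measure R]_t
    (\1_(`[1%R, expR epsilon[%classic) t * stair ((ln t - ln y) / epsilon))%:E
  = ((expR epsilon - 1) * y)%:E.
Proof.
move=> y0; pose z := (- ln y / epsilon)%R; pose k := Num.floor z.
have e0 : epsilon != 0%R by rewrite gt_eqF.
have /andP[kz zk] : (k%:~R <= z < (k + 1)%:~R)%R by exact: floor_itv.
rewrite intrD in zk.
(* [T] is the level at which the floor passes from k to k + 1; on either side of it the integrand is
   constant. *)
pose T := expR (epsilon * (1 - (z - k%:~R)))%R.
have T1 : (1 <= T)%R.
  by rewrite -expR0 ler_expR mulr_ge0// ?(ltW epsilon_gt0)//; lra.
have Te : (T <= expR epsilon)%R.
  by rewrite ler_expR ler_piMr// ?(ltW epsilon_gt0)//; lra.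
transitivity (\int[@lebesgue_measure R]_t
   ((expR (- k%:~R * epsilon))%:E * (\1_(`[1%R, T[%classic) t)%:E +
    (expR (- (k + 1)%:~R * epsilon))%:E * (\1_(`[T, expR epsilon[%classic) t)%:E)).
  apply: eq_integral => t _; rewrite -!EFinM -EFinD; congr EFin.
  rewrite !indicE !mem_setE !in_itv/=.
  have [t1|t1] := leP 1%R t; last first.
    by rewrite /= (leNgt T) (lt_le_trans t1 T1)/= !(mul0r, mulr0) addr0.
  have t0 : (0 < t)%R by exact: lt_le_trans t1.
  have -> : ((ln t - ln y) / epsilon = ln t / epsilon + z)%R by rewrite /z mulrBl mulNr.
  have lt0 : (0 <= ln t / epsilon)%R by rewrite divr_ge0 ?ln_ge0// ltW.
  rewrite /=; have [tT|tT] /= := ltP t T.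
    rewrite (lt_le_trans tT Te)/= mul1r mulr1 mulr0 addr0.
    have : (ln t / epsilon < 1 - (z - k%:~R))%R.
      by rewrite ltr_pdivrMr// mulrC -ltr_expR lnK.
    move=> tk; rewrite /stair (@floor_def _ _ k)// intrD.
    by apply/andP; split; lra.
  have [te|te] := ltP t (expR epsilon); last by rewrite /= !(mul0r, mulr0) addr0.
  rewrite /= mul1r mulr1 mulr0 add0r.
  have : (1 - (z - k%:~R) <= ln t / epsilon)%R.
    by rewrite ler_pdivlMr// mulrC -ler_expR lnK.
  have : (ln t / epsilon < 1)%R.
    by rewrite ltr_pdivrMr// mul1r -ltr_expR lnK.
  move=> tk kt; rewrite /stair (@floor_def _ _ (k + 1)%R)// !intrD.
  by apply/andP; split; lra.
have mi (a b : R) : measurable_fun [set: measurableTypeR R]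
    (fun t : R => (\1_(`[a, b[%classic) t)%:E : \bar R).
  by apply/measurable_EFinP; exact: measurable_indic.
have i1 (a b : R) : (a <= b)%R ->
    \int[@lebesgue_measure R]_t (\1_(`[a, b[%classic) t)%:E = (b - a)%:E.
  move=> ab; transitivity (@lebesgue_measure R `[a, b[%classic).
    by rewrite integral_indic// setIT.
  rewrite lebesgue_measure_itv/= lte_fin.
  by move: ab; rewrite le_eqVlt => /predU1P[->|->//]; rewrite ltxx subrr.
rewrite ge0_integralTD; first last.
- by move=> t; rewrite mule_ge0 ?lee_fin ?expR_ge0.
- by move=> t; rewrite mule_ge0 ?lee_fin ?expR_ge0.
- by apply: measurable_funeM; exact: mi.
- by apply: measurable_funeM; exact: mi.
rewrite !ge0_integralTZl ?expR_ge0//; try by move=> t; rewrite lee_fin.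
rewrite !i1//.
rewrite -!EFinM -EFinD; congr EFin.
have -> : (expR (- (k + 1)%:~R * epsilon) = expR (- k%:~R * epsilon) * (expR epsilon)^-1)%R.
  by rewrite intrD opprD mulrDl expRD mulN1r expRN.
(* With K, E for the two exponentials, the integral is K (T - 1) + (K / E) (E - T) = K T (1 - 1 /
   E), so K T = E y finishes the computation. *)
have : (expR (- k%:~R * epsilon) * T = expR epsilon * y)%R.
  rewrite -expRD -[in RHS](@lnK _ y)// -expRD; congr expR.
  by rewrite /z; field.
have := expR_gt0 epsilon.
move: (expR _) T (expR epsilon) {T1 Te} => K T E E0 H.
have -> : (K * (T - 1) + K / E * (E - T) = K * T * (1 - E^-1))%R.
  by field; rewrite gt_eqF.
by rewrite H; field; rewrite gt_eqF.
Qed.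

End stair.

(** * The one-dimensional inequality *)

Section ray.
Context {R : realType}.
Local Open Scope ereal_scope.
Notation leb := (@lebesgue_measure R).

Lemma nondecreasing_emeasurable (phi : R -> \bar R) :
  (forall r s, (r <= s)%R -> phi r <= phi s) -> measurable_fun setT phi.
Proof.
move=> nd; apply: (measurability _ (ErealGenOInfty.measurableE R)).
move=> _ [_ [x ->] <-]; rewrite setTI; apply: is_interval_measurable => a b/=.
rewrite !in_itv/= !andbT => xa _ c /andP[ac _].
by rewrite in_itv/= andbT (lt_le_trans xa)// nd.
Qed.

(** This is (b - a) (x - M) >= 0, expanded so that no difference is formed and x may be infinite. *)
Lemma crossing_le (a b M : R) (x : \bar R) : (0 <= a)%R -> (0 <= b)%R ->
  (M%:E <= x /\ (a <= b)%R) \/ (x <= M%:E /\ (b <= a)%R) -> 0 <= x ->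
  a%:E * x + b%:E * M%:E <= b%:E * x + a%:E * M%:E.
Proof.
case: x => [x| |] a0 b0 //.
  by rewrite -!EFinM -!EFinD !lee_fin => -[[Mx ab]|[xM ba]] x0; nra.
case=> [[_ ab] _|[]]; last by [].
have [b00|b1] := eqVneq b 0%R.
  have a00 : a = 0%R by apply/eqP; rewrite eq_le a0 -b00 ab.
  by rewrite a00 b00 !mul0e.
by rewrite [b%:E * +oo]gt0_muley ?lte_fin ?lt_neqAle 1?eq_sym ?b1// addye// leey.
Qed.

Variables (epsilon Delta : R).
Hypothesis epsilon_gt0 : (0 < epsilon)%R.
Hypothesis Delta_gt0 : (0 < Delta)%R.
Variable w : R -> R.
Hypothesis mw : measurable_fun setT w.
Hypothesis w_ge0 : forall r, (0 <= w r)%R.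
Variable phi : R -> \bar R.
Hypothesis phi_ge0 : forall r, 0 <= phi r.
Hypothesis phi_nd : forall r s, (r <= s)%R -> phi r <= phi s.
Variable M : R.
Hypothesis M_ge0 : (0 <= M)%R.
Let s (gamma r : R) := stair epsilon (r / Delta + 1 - gamma).
Hypothesis staircase_fin : forall gamma, (0 <= gamma <= 1)%R ->
  \int[leb]_r (w r * s gamma r)%:E < +oo.
Hypothesis staircase_ge : forall gamma, (0 <= gamma <= 1)%R ->
  \int[leb]_r (w r * s gamma r)%:E * M%:E <=
  \int[leb]_r ((w r * s gamma r)%:E * phi r).
Hypothesis phi_ltM : exists r, phi r < M%:E.
Hypothesis phi_geM : exists r, M%:E <= phi r.

Let mphi : measurable_fun setT phi.
Proof. exact: nondecreasing_emeasurable. Qed.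

Let ms gamma : measurable_fun setT (s gamma).
Proof.
apply: measurableT_comp; first exact: measurable_stair.
by apply: measurable_funB => //; apply: measurable_funD => //; apply: measurable_funM.
Qed.

Lemma ge_threshold_step (kappa : R -> int) (h := fun r => expR (- (kappa r)%:~R * epsilon)) :
  (forall r r', `|r - r'| <= Delta -> kappa r <= kappa r' + 1)%R ->
  measurable_fun setT h ->
  \int[leb]_r (w r * h r)%:E * M%:E <= \int[leb]_r ((w r * h r)%:E * phi r).
Proof.
move=> kappa_step mh.
pose r0 := sup [set r | phi r < M%:E].
have [r1 r1M] := phi_ltM; have [r2 r2M] := phi_geM.
have ub2 : ubound [set r | phi r < M%:E] r2.
  move=> r /= rM; rewrite leNgt; apply/negP => /ltW/phi_nd r2r.
  by have := lt_le_trans rM (le_trans r2M r2r); rewrite ltxx.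
have supr0 : has_sup [set r | phi r < M%:E] by split; [exists r1|exists r2].
have below r : (r < r0)%R -> phi r <= M%:E.
  rewrite -subr_gt0 => /sup_adherent/(_ supr0)[r' /= r'M]; rewrite -/r0 subKr => rr'.
  by rewrite (le_trans _ (ltW r'M))// phi_nd// ltW.
have above r : (r0 < r)%R -> M%:E <= phi r.
  rewrite !leNgt => rr0; apply/negP => rM; move: rr0; apply/negP; rewrite -leNgt.
  by apply: ub_le_sup => //; exists r2.
have [rho [p crossing]] := staircase_crossing Delta_gt0 kappa_step r0.
(* The jumps of [s gamma] are at (gamma + Z) Delta, so gamma must be rho / Delta modulo 1. The
   factor [C] then adjusts the levels to those of the staircase based at rho and p. *)
pose m := Num.floor (rho / Delta).
pose gamma := (rho / Delta - m%:~R)%R.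
have /andP[m1 m2] : (m%:~R <= rho / Delta < (m + 1)%:~R)%R by exact: floor_itv.
have gamma01 : (0 <= gamma <= 1)%R.
  by rewrite intrD in m2; rewrite /gamma; apply/andP; split; lra.
pose C := expR ((m + 1 - p)%:~R * epsilon).
pose J r := (p + Num.floor ((r - rho) / Delta))%R.
have CsE r : (C * s gamma r = expR (- (J r)%:~R * epsilon))%R.
  rewrite /s; have -> : (r / Delta + 1 - gamma = (r - rho) / Delta + (m + 1)%:~R)%R.
    by rewrite /gamma intrD; field; rewrite gt_eqF.
  rewrite stairDz /stair /C /J -!expRD; congr expR.
  by rewrite !(intrD, intrN); ring.
have C0 : (0 <= C)%R by exact: expR_ge0.
have msg := ms gamma.
have s0 r : (0 <= s gamma r)%R by exact: stair_ge0.
have h0 r : (0 <= h r)%R by exact: expR_ge0.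
have wCs0 r : (0 <= w r * (C * s gamma r))%R by rewrite !mulr_ge0.
have wh0 r : (0 <= w r * h r)%R by rewrite mulr_ge0.
have mwCs : measurable_fun setT (fun r => (w r * (C * s gamma r))%:E).
  by apply/measurable_EFinP; apply: measurable_funM => //; apply: measurable_funM.
have mwh : measurable_fun setT (fun r => (w r * h r)%:E).
  by apply/measurable_EFinP; apply: measurable_funM.
have mwCsphi : measurable_fun setT (fun r => (w r * (C * s gamma r))%:E * phi r).
  exact: emeasurable_funM.
have mwhphi : measurable_fun setT (fun r => (w r * h r)%:E * phi r).
  exact: emeasurable_funM.
have mwCsM : measurable_fun setT (fun r => (w r * (C * s gamma r))%:E * M%:E).
  exact: emeasurable_funM.
have mwhM : measurable_fun setT (fun r => (w r * h r)%:E * M%:E).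
  exact: emeasurable_funM.
have key : \int[leb]_r ((w r * (C * s gamma r))%:E * phi r + (w r * h r)%:E * M%:E)
  <= \int[leb]_r ((w r * h r)%:E * phi r + (w r * (C * s gamma r))%:E * M%:E).
  apply: ae_ge0_le_integral => //.
  - by move=> r _; rewrite adde_ge0// mule_ge0// lee_fin.
  - exact: emeasurable_funD.
  - by move=> r _; rewrite adde_ge0// mule_ge0// lee_fin.
  - exact: emeasurable_funD.
  (* The jump points and r0, where the crossing says nothing, form a countable and hence null
     set. *)
  pose E := range (fun o : option int =>
    if o is Some k then rho + k%:~R * Delta else r0)%R.
  have cE : countable E by exact: sub_countable (card_image_le _ _) (countableP _).
  exists E; split.
  - exact: countable_measurable.
  - exact: countable_lebesgue_measure0.
  move=> r /=; apply: contra_notP => rE _.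
  have rk (k : int) : (r != rho + k%:~R * Delta)%R.
    by apply/eqP => rk; apply: rE; exists (Some k).
  have [lt_r0 gt_r0] := crossing r rk.
  apply: crossing_le => //; rewrite CsE.
  have [rr0|rr0|rr0] := ltgtP r r0.
  - right; split; first exact: below.
    rewrite ler_wpM2l// ler_expR ler_wpM2r ?(ltW epsilon_gt0)// lerN2 ler_int.
    exact: lt_r0.
  - left; split; first exact: above.
    rewrite ler_wpM2l// ler_expR ler_wpM2r ?(ltW epsilon_gt0)// lerN2 ler_int.
    exact: gt_r0.
  - by exfalso; apply: rE; exists None.
have EX : \int[leb]_r ((w r * (C * s gamma r))%:E * phi r) =
    C%:E * \int[leb]_r ((w r * s gamma r)%:E * phi r).
  rewrite -ge0_integralTZl//.
  - by apply: eq_integral => r _; rewrite mulrCA EFinM muleA.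
  - apply: emeasurable_funM => //; apply/measurable_EFinP.
    exact: measurable_funM.
  - by move=> r; rewrite mule_ge0// lee_fin mulr_ge0.
have EY : \int[leb]_r ((w r * (C * s gamma r))%:E * M%:E) =
    C%:E * (\int[leb]_r (w r * s gamma r)%:E * M%:E).
  rewrite ge0_integralTZr// muleA -ge0_integralTZl//.
  - by congr (_ * _); apply: eq_integral => r _; rewrite mulrCA EFinM.
  - by apply/measurable_EFinP; apply: measurable_funM.
  - by move=> r; rewrite lee_fin mulr_ge0.
rewrite !ge0_integralTD// in key; try by move=> r; rewrite mule_ge0 ?lee_fin.
rewrite [X in _ + X <= _]ge0_integralTZr// in key.
(* The term to be cancelled is M times the mass of the staircase, which is finite; the mass of [h]
   need not be. *)
have Yfin : \int[leb]_r ((w r * (C * s gamma r))%:E * M%:E) \is a fin_num.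
  rewrite EY fin_numM// fin_numM// ge0_fin_numE ?staircase_fin//.
  by apply: integral_ge0 => r _; rewrite lee_fin mulr_ge0.
rewrite -(leeD2lE _ _ Yfin) (le_trans _ (le_trans key _))//; last by rewrite addeC.
by rewrite leeD2r// EX EY lee_wpmul2l ?lee_fin ?staircase_ge.
Qed.

Lemma ge_threshold_ray (g : R -> R) : measurable_fun setT g ->
  (forall r, 0 < g r)%R ->
  (forall r r', `|r - r'| <= Delta -> g r <= expR epsilon * g r')%R ->
  \int[leb]_r (w r * g r)%:E * M%:E <= \int[leb]_r ((w r * g r)%:E * phi r).
Proof.
move=> mg g0 gdp; pose h t r := stair epsilon ((ln t - ln (g r)) / epsilon).
have h0 t r : (0 <= h t r)%R by exact: stair_ge0.
have mht t : measurable_fun setT (h t).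
  apply: measurableT_comp; first exact: measurable_stair.
  apply: measurable_funM => //; apply: measurable_funB => //.
  exact: measurableT_comp (@measurable_ln R) mg.
have mh : measurable_fun setT (fun z : R * R => h z.2 z.1).
  apply: measurableT_comp; first exact: measurable_stair.
  apply: measurable_funM => //; apply: measurable_funB => //.
    exact: measurableT_comp (@measurable_ln R) measurable_snd.
  exact: measurableT_comp (@measurable_ln R) (measurableT_comp mg measurable_fst).
pose D : set R := `[1%R, expR epsilon[%classic.
have mD : measurable_fun setT (\1_D : R -> R) by apply: measurable_indic; exact: measurable_itv.
have e1 : (0 < expR epsilon - 1)%R by rewrite subr_gt0 -expR0 ltr_expR.
pose G psi t := (\1_D t)%:E * \int[leb]_r ((w r * h t r)%:E * psi r).
(* Averaging over one period of levels t turns [h t] into a multiple of [g], by Tonelli and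
   [integral_stair_ln]. It is applied to the constant M and to [phi], that is, to both sides of the
   claim. *)
have avg (psi : R -> \bar R) : measurable_fun setT psi -> (forall r, 0 <= psi r) ->
    measurable_fun setT (G psi) /\
    (expR epsilon - 1)%:E * \int[leb]_r ((w r * g r)%:E * psi r) =
    \int[leb]_t G psi t.
  move=> mpsi psi0.
  pose F (z : R * R) := (\1_D z.2 * h z.2 z.1)%:E * ((w z.1)%:E * psi z.1).
  have mF : measurable_fun setT F.
    apply: emeasurable_funM.
      apply/measurable_EFinP; apply: measurable_funM => //.
      exact: measurableT_comp mD measurable_snd.
    apply: emeasurable_funM.
      by apply/measurable_EFinP; exact: measurableT_comp mw measurable_fst.
    exact: measurableT_comp mpsi measurable_fst.
  have F0 z : 0 <= F z by rewrite !mule_ge0 ?lee_fin ?mulr_ge0.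
  have GE : G psi = fubini_G leb F.
    apply/funext => t; rewrite /G -ge0_integralTZl//.
    - by apply: eq_integral => r _; rewrite /F/= !EFinM [RHS]muleACA !muleA.
    - apply: emeasurable_funM => //; apply/measurable_EFinP.
      by apply: measurable_funM => //; exact: mht.
    - by move=> r; rewrite mule_ge0// lee_fin mulr_ge0.
  split; first by rewrite GE; exact: measurable_fun_fubini_tonelli_G.
  rewrite GE; apply: (etrans _ (fubini_tonelli (m1 := leb) (m2 := leb) F mF F0)).
  rewrite -ge0_integralTZl ?(ltW e1)//; last 2 first.
  - apply: emeasurable_funM => //; apply/measurable_EFinP.
    exact: measurable_funM.
  - by move=> r; rewrite mule_ge0// lee_fin mulr_ge0// ltW.
  apply: eq_integral => r _.
  transitivity (\int[leb]_t ((\1_D t * h t r)%:E * ((w r)%:E * psi r))) => //.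
  rewrite ge0_integralTZr; first last.
  - by rewrite mule_ge0// lee_fin.
  - by move=> t; rewrite lee_fin mulr_ge0.
  - apply/measurable_EFinP; apply: measurable_funM.
      exact: mD.
    exact: measurableT_comp mh (measurable_pair1 r).
  by rewrite integral_stair_ln// !EFinM [RHS]muleACA !muleA.
have [mGM avgM] := avg _ (measurable_cst M%:E) (fun=> M_ge0).
have [mGphi avgphi] := avg _ mphi phi_ge0.
rewrite -ge0_integralTZr//; first last.
- by move=> r; rewrite lee_fin mulr_ge0// ltW.
- by apply/measurable_EFinP; exact: measurable_funM.
rewrite -(lee_pmul2l _ (_ : 0 < (expR epsilon - 1)%:E))// ?lte_fin//.
rewrite avgphi [leLHS]avgM; apply: ge0_le_integralT => // t.
  rewrite mule_ge0 ?lee_fin//; apply: integral_ge0 => r _.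
  by rewrite mule_ge0 ?lee_fin// mulr_ge0.
rewrite lee_wpmul2l ?lee_fin// ge0_integralTZr//; first last.
- by move=> r; rewrite lee_fin mulr_ge0.
- by apply/measurable_EFinP; apply: measurable_funM => //; exact: mht.
apply: (@ge_threshold_step (fun r => Num.floor ((ln t - ln (g r)) / epsilon)%R)); last exact: mht.
(* After taking logarithms and dividing by epsilon, the privacy bound says that the argument of the
   floor grows by at most 1. *)
move=> r r' rr'; have : (g r' <= expR epsilon * g r)%R by apply: gdp; rewrite distrC.
rewrite -ler_ln ?posrE ?mulr_gt0 ?expR_gt0// lnM ?posrE ?expR_gt0// expRK => gr.
rewrite -[X in (_ <= _ + X)%R](@intrKfloor R) -floorDrz ?intr_int//; apply: le_floor.
rewrite -(ler_pM2r epsilon_gt0) [leRHS]mulrDl !divfK ?gt_eqF// mul1r; lra.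
Qed.

End ray.

(** * Norms on row vectors *)

Lemma normr_coord_le {R : realType} n (x : 'rV[R]_n) j : `|x ord0 j| <= `|x|.
Proof.
by rewrite [leRHS]/Num.Def.normr/= mx_normrE; apply/bigmax_geP; right; exists (ord0, j).
Qed.

Section norm.
Context {R : realType} {n : nat}.
Variable N : 'rV[R]_n -> R.
Hypothesis N_norm : is_norm N.

Lemma is_normZ (a : R) x : N (a *: x) = `|a| * N x. Proof. by case: N_norm. Qed.

Lemma is_norm0 : N 0 = 0.
Proof. by rewrite -(scale0r 0) is_normZ normr0 mul0r. Qed.

Lemma is_normN x : N (- x) = N x.
Proof. by rewrite -scaleN1r is_normZ normrN1 mul1r. Qed.

Lemma is_norm_ge0 x : 0 <= N x.
Proof.
case: N_norm => NM _ _; have := NM x (- x).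
by rewrite subrr is_norm0 is_normN -mulr2n pmulrn_lge0.
Qed.

Lemma is_norm_gt0 x : x != 0 -> 0 < N x.
Proof.
move=> x0; rewrite lt_neqAle is_norm_ge0 andbT eq_sym.
by apply: contra x0 => /eqP; case: N_norm => _ _ N0 /N0 ->.
Qed.

Lemma is_norm_lipschitz x y : `|N x - N y| <= N (x - y).
Proof.
case: N_norm => NM _ _; rewrite ler_norml lerNl opprB; apply/andP; split.
  rewrite -[N (x - y)]is_normN opprB lerBlDr.
  by rewrite (le_trans _ (NM _ _))// subrK.
by rewrite lerBlDr (le_trans _ (NM _ _))// subrK.
Qed.

(** Expand x in the standard basis. Comparison with the sup norm makes [N] continuous for the usual
    topology, hence Borel. *)
Lemma is_norm_le_sup : exists2 c, 0 < c & forall x, N x <= c * `|x|.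
Proof.
pose c := 1 + \sum_(j < n) N (delta_mx 0 j).
have c1 : 0 < c by rewrite ltr_pwDl// sumr_ge0// => j _; exact: is_norm_ge0.
exists c => // x.
have NS (I : seq 'I_n) (F : 'I_n -> 'rV[R]_n) :
    N (\sum_(j <- I) F j) <= \sum_(j <- I) N (F j).
  elim: I => [|i I IH]; first by rewrite !big_nil is_norm0.
  rewrite !big_cons; case: N_norm => NM _ _.
  by rewrite (le_trans (NM _ _))// lerD2l.
rewrite [in leLHS](row_sum_delta x) (le_trans (NS _ _))//.
apply: (@le_trans _ _ (\sum_(j < n) N (delta_mx 0 j) * `|x|)).
  apply: ler_sum => j _; rewrite is_normZ mulrC ler_wpM2l ?is_norm_ge0//.
  exact: normr_coord_le.
by rewrite -mulr_suml ler_wpM2r// /c lerDr.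
Qed.

Lemma is_norm_continuous : continuous N.
Proof.
have [c c0 Nc] := is_norm_le_sup.
move=> x; apply/(@cvgrPdist_lt _ _ _ (nbhs (x : 'rV[R]_n))) => e e0; near=> y.
rewrite (le_lt_trans (is_norm_lipschitz _ _))// (le_lt_trans (Nc _))//.
rewrite mulrC -ltr_pdivlMr//.
near: y.
have : nbhs x (ball x (e / c)) by apply: nbhsx_ballx; rewrite divr_gt0.
by rewrite -ball_normE.
Unshelve. all: by end_near. Qed.

Lemma measurable_is_norm : measurable_fun setT N.
Proof.
apply: (measurability _ (measurable_realfun.RGenOpens.measurableE R)) => //.
move=> _ [_ [a [b ->]] <-]; rewrite setTI.
apply: sub_sigma_algebra; apply: open_comp => //.
by move=> x _; exact: is_norm_continuous.
Qed.

(** The constant is the minimum of [N] on the compact unit sphere of the sup norm, which is nonempty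
    because n > 0. It keeps the shell 1 <= N < 2 bounded. *)
Lemma is_norm_ge_sup : (0 < n)%N -> exists2 c, 0 < c & forall x, c * `|x| <= N x.
Proof.
move=> n0; pose S := [set x : 'rV[R]_n | `|x| = 1].
have cS : compact S.
  apply: bounded_closed_compact.
    exists 1; split=> // M M1 x /= ->; exact: ltW.
  by apply: (closed_comp _ (@closed_eq _ (1 : R))) => x _; exact: norm_continuous.
have [x0 Sx0] : S !=set0.
  have v0 : (const_mx 1 : 'rV[R]_n) != 0.
    apply/eqP => /matrixP/(_ ord0 (Ordinal n0)); rewrite !mxE => /eqP.
    by rewrite oner_eq0.
  exists (`|const_mx 1 : 'rV[R]_n|^-1 *: const_mx 1).
  by rewrite /S/= normrZ normfV normr_id mulVf// normr_eq0.
have [x Sx minx] := EVT_min_rV (ex_intro _ x0 Sx0) cS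
  (continuous_subspaceT is_norm_continuous).
exists (N x).
  apply: is_norm_gt0; apply/eqP => xE; move: Sx; rewrite inE /S/= xE normr0 => /esym/eqP.
  by rewrite oner_eq0.
move=> y; have [->|y0] := eqVneq y 0; first by rewrite normr0 mulr0 is_norm0.
have Ny : 0 < `|y| by rewrite normr_gt0.
have /minx : `|y|^-1 *: y \in S.
  by rewrite inE /S/= normrZ normfV normr_id mulVf ?gt_eqF.
by rewrite is_normZ normfV normr_id ler_pdivlMl// mulrC.
Qed.

End norm.

(** * Polar coordinates *)

Section polar.
Context {R : realType} {n : nat}.
Notation leb := (@lebesgue_measure R).
Notation vol := (@lebesgue_rV R n.+1).
Variable N : 'rV[R]_n.+1 -> R.
Hypothesis N_norm : is_norm N.
Local Open Scope ereal_scope.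

(** The polar Jacobian: the space has dimension n + 1, hence the exponent n. *)
Definition radial_weight (r : R) : R := (\1_(`]0%R, +oo[%classic) r * r ^+ n)%R.

Lemma radial_weight_ge0 r : (0 <= radial_weight r)%R.
Proof.
rewrite /radial_weight indicE mem_setE in_itv/= andbT.
by have [r0|] := ltP 0%R r; rewrite ?mul0r// mul1r exprn_ge0// ltW.
Qed.

Lemma measurable_radial_weight : measurable_fun setT radial_weight.
Proof.
by apply: measurable_funM => //; apply: measurable_indic; exact: measurable_itv.
Qed.

Definition shell (x : 'rV[R]_n.+1) : R := \1_(`[1%R, 2%R[%classic) (N x).

Lemma shellE x : shell x = ((1 <= N x < 2)%R)%:R.
Proof. by rewrite /shell indicE mem_setE in_itv. Qed.

Lemma shell_ge0 x : (0 <= shell x)%R. Proof. by rewrite shellE. Qed.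

Lemma measurable_shell : measurable_fun setT shell.
Proof.
apply: measurableT_comp; last exact: (measurable_is_norm N_norm).
by apply: measurable_indic; exact: measurable_itv.
Qed.

Lemma measurable_is_normV : measurable_fun setT (fun x => (N x)^-1)%R.
Proof.
rewrite (_ : (fun _ => _) = (@powR R ^~ (- 1)%R) \o N).
  by apply: measurableT_comp; [exact: measurable_powR|exact: (measurable_is_norm N_norm)].
by apply/funext => x /=; rewrite powR_inv1// is_norm_ge0.
Qed.

(** Takes the place of surface measure on the unit sphere, with the points of the shell 1 <= N < 2
    standing for directions. One factor 1 / N x comes from the kernel [c] below; the substitution r
    = N x * s contributes the other n + 1. *)
Definition direction_weight (x : 'rV[R]_n.+1) : R := (2 * shell x / N x ^+ n.+2)%R.

Lemma direction_weight_ge0 x : (0 <= direction_weight x)%R.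
Proof. by rewrite divr_ge0 ?exprn_ge0 ?is_norm_ge0// mulr_ge0// shell_ge0. Qed.

Lemma measurable_direction_weight : measurable_fun setT direction_weight.
Proof.
rewrite /direction_weight; under eq_fun do rewrite -exprVn.
apply: measurable_funM; last by apply: measurable_funX; exact: measurable_is_normV.
by apply: measurable_funM => //; exact: measurable_shell.
Qed.

Lemma rV_set1_box : [set 0%R] = [set x : 'rV[R]_n.+1 | forall i, [set 0%R] (x ord0 i)].
Proof.
apply/seteqP; split => [x /= -> i|x /= x0]; first by rewrite mxE.
by apply/rowP => i; rewrite x0 mxE.
Qed.

Lemma measurable_rV_set1 : measurable [set 0%R : 'rV[R]_n.+1].
Proof. by rewrite rV_set1_box; apply: (measurable_box (A := fun=> [set 0%R])). Qed.

Lemma lebesgue_rV_set1 : vol [set 0%R] = 0.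
Proof.
rewrite rV_set1_box (lebesgue_rV_box (A := fun=> [set 0%R]))// big_ord_recl.
by rewrite lebesgue_measure_set1 mul0e.
Qed.

Section polar_integrand.
Variable h : 'rV[R]_n.+1 -> \bar R.
Hypothesis mh : measurable_fun setT h.
Hypothesis h0 : forall x, 0 <= h x.

(** Normalised so that every y != 0 is counted once: after y = s x the coefficient is 2 / N y, and
    the admissible s form an interval of length N y / 2. *)
Let c (x : 'rV[R]_n.+1) (s : R) : R :=
  (2 * radial_weight s * shell x / N x)%R.

Let F (z : 'rV[R]_n.+1 * R) : \bar R := (c z.1 z.2)%:E * h (z.2 *: z.1)%R.

Let c_ge0 x s : (0 <= c x s)%R.
Proof.
by rewrite divr_ge0 ?is_norm_ge0// mulr_ge0 ?shell_ge0// mulr_ge0// radial_weight_ge0.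
Qed.

Let F_ge0 z : 0 <= F z.
Proof. by rewrite mule_ge0 ?lee_fin ?c_ge0. Qed.

Let mF : measurable_fun setT F.
Proof.
apply: emeasurable_funM.
  apply/measurable_EFinP; apply: measurable_funM; last first.
    exact: measurableT_comp measurable_is_normV measurable_fst.
  apply: measurable_funM; last exact: measurableT_comp measurable_shell measurable_fst.
  apply: measurable_funM => //.
  exact: measurableT_comp measurable_radial_weight measurable_snd.
apply: measurableT_comp; first exact: mh.
exact: (measurable_fun_rVZ measurable_snd measurable_fst).
Qed.

(** The ray through x is parametrised by the norm: for N x > 0 and r > 0 the point (r / N x) x has
    norm r. *)
Definition ray_integral x := \int[leb]_r ((radial_weight r)%:E * h ((r / N x) *: x)%R).

Let m_ray x : measurable_fun setT
  (fun r : R => (radial_weight r)%:E * h ((r / N x) *: x)%R).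
Proof.
apply: emeasurable_funM; first by apply/measurable_EFinP; exact: measurable_radial_weight.
apply: measurableT_comp; first exact: mh.
by apply: measurable_fun_rVZ; [exact: mulrr_measurable|exact: measurable_cst].
Qed.

Let fubini_rayE x : fubini_F leb F x = (direction_weight x)%:E * ray_integral x.
Proof.
have [xS|xS] := boolP (1 <= N x < 2)%R; last first.
  rewrite /direction_weight shellE (negbTE xS) mulr0 mul0r mul0e.
  apply: integral0_eq => s _; rewrite /F /c/= shellE (negbTE xS).
  by rewrite mulr0 mul0r mul0e.
have Nx0 : (0 < N x)%R by case/andP: xS => x1 _; exact: lt_le_trans x1.
have Nx1 : N x != 0%R by rewrite gt_eqF.
pose k : R := (2 / N x ^+ n.+1)%R.
have k0 : (0 <= k)%R by rewrite divr_ge0 ?exprn_ge0 ?ltW.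
transitivity (\int[leb]_s (k%:E *
   ((radial_weight (N x * s))%:E * h (((N x * s) / N x) *: x)%R))).
  apply: eq_integral => s _; rewrite /F /c/= shellE xS mulr1.
  rewrite [(N x * s)%R]mulrC mulfK ?gt_eqF// muleA -EFinM; congr ((_)%:E * _).
  rewrite /radial_weight !indicE !mem_setE !in_itv/= !andbT pmulr_lgt0//.
  case: (0 < s)%R; rewrite ?(mul0r, mulr0)// !mul1r exprMn /k exprS.
  by field; rewrite ?expf_neq0 Nx1.
rewrite ge0_integralTZl//; last 2 first.
- apply: (measurableT_comp (m_ray x)); exact: mulrl_measurable.
- by move=> s; rewrite mule_ge0 ?lee_fin ?radial_weight_ge0.
rewrite (@integral_scale _ _ (fun r => (radial_weight r)%:E * h ((r / N x) *: x)%R))//; last first.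
  by move=> s; rewrite mule_ge0 ?lee_fin ?radial_weight_ge0.
rewrite muleA -EFinM; congr ((_)%:E * _).
by rewrite /direction_weight shellE xS mulr1 /k [in RHS]exprS; field; rewrite ?expf_neq0 Nx1.
Qed.

Lemma measurable_ray_integral :
  measurable_fun setT (fun x => (direction_weight x)%:E * ray_integral x).
Proof.
have := measurable_fun_fubini_tonelli_F (m2 := leb) _ mF F_ge0.
by congr measurable_fun; apply/funext => x; rewrite fubini_rayE.
Qed.

(* Tonelli on the pairs (x, s) with x in the shell [1 <= N x < 2]: integrating
   over x first and rescaling y = s x, the values of s that see a given y form
   the interval `]N y / 2, N y]. *)
Lemma polar_integral :
  \int[vol]_x h x = \int[vol]_x ((direction_weight x)%:E * ray_integral x).
Proof.
transitivity (\int[vol]_x fubini_F leb F x); last first.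
  by apply: eq_integral => x _; rewrite fubini_rayE.
apply: esym; apply: (etrans (fubini_tonelli (m1 := vol) (m2 := leb) F mF F_ge0)).
(* For s > 0, membership of (y, s) says that y / s lies in the shell. *)
pose A := [set z : 'rV[R]_n.+1 * R | (z.2 <= N z.1 < 2 * z.2)%R].
have AE y s : (\1_A (y, s) : R) = ((s <= N y < 2 * s)%R)%:R by rewrite indicE mem_setE.
have mN : measurable_fun setT (fun z : 'rV[R]_n.+1 * R => (N z.1)%:E).
  by apply/measurable_EFinP; exact: measurableT_comp (measurable_is_norm N_norm) measurable_fst.
have mA : measurable A.
  rewrite (_ : A = (setT `&` [set z | z.2%:E <= (N z.1)%:E]) `&`
                   (setT `&` [set z | (N z.1)%:E < (2 * z.2)%:E])).
    apply: measurableI; [apply: measurable_lee|apply: measurable_lte] => //.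
      by apply/measurable_EFinP; exact: measurable_snd.
    by apply/measurable_EFinP; apply: measurable_funM => //; exact: measurable_snd.
  by rewrite !setTI; apply/seteqP; split=> z /=; rewrite !lee_fin lte_fin => /andP.
pose G (z : 'rV[R]_n.+1 * R) : \bar R := (2 / N z.1 * \1_A z)%:E * h z.1.
have mG : measurable_fun setT G.
  apply: emeasurable_funM; last exact: measurableT_comp mh measurable_fst.
  apply/measurable_EFinP; apply: measurable_funM; last exact: measurable_indic.
  by apply: measurable_funM => //; exact: measurableT_comp measurable_is_normV measurable_fst.
have G0 z : 0 <= G z.
  by rewrite mule_ge0// lee_fin mulr_ge0// divr_ge0// is_norm_ge0.
transitivity (\int[leb]_s \int[vol]_y G (y, s)).
  apply: eq_integral => s _.
  have [s0|s0] := leP s 0%R.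
    transitivity (0 : \bar R).
      apply: integral0_eq => x _.
      by rewrite /F /c/= /radial_weight indicE mem_setE in_itv/= andbT ltNge s0 !(mul0r, mulr0) mul0e.
    apply: esym; apply: integral0_eq => y _; rewrite /G/= AE.
    have -> : (s <= N y < 2 * s)%R = false.
      apply/negP => /andP[_]; rewrite ltNge => /negP; apply.
      by rewrite (le_trans _ (is_norm_ge0 N_norm y))// mulr_ge0_le0.
    by rewrite mulr0 mul0e.
  have s1 : s != 0%R by rewrite gt_eqF.
  have sn0 : (0 <= s ^+ n.+1)%R by rewrite exprn_ge0 ?ltW.
  pose H y := (s ^+ n.+1)%:E * G (y, s).
  have mGs : measurable_fun setT (fun y => G (y, s)).
    exact: measurableT_comp mG (measurable_pair2 s).
  have mH : measurable_fun setT H by exact: measurable_funeM.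
  have H0 y : 0 <= H y by rewrite mule_ge0.
  transitivity (\int[vol]_x H (s *: x)%R).
    apply: eq_integral => x _; rewrite /F /H /G /c/= AE shellE muleA -EFinM.
    congr ((_)%:E * _); rewrite (is_normZ N_norm) (gtr0_norm s0).
    rewrite ler_pMr// [(2 * s)%R]mulrC ltr_pM2l//.
    rewrite /radial_weight indicE mem_setE in_itv/= andbT s0.
    have [->|Nx0] := eqVneq (N x) 0%R; first by rewrite ler10 !(mulr0, mul0r).
    by rewrite mul1r exprS; field; rewrite s1 Nx0.
  apply: (etrans (integral_rV_scale s0 mH H0)).
  rewrite /H ge0_integralTZl// muleA -EFinM mulVf ?mul1e//.
  by rewrite expf_neq0.
apply: (etrans (esym (fubini_tonelli (m1 := vol) (m2 := leb) G mG G0))).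
have GE y : y != 0%R -> \int[leb]_s G (y, s) = h y.
  move=> y0; have Ny0 : (0 < N y)%R by exact: is_norm_gt0.
  transitivity (\int[leb]_s ((2 / N y)%:E * (\1_(`](N y / 2)%R, N y]%classic) s)%:E * h y)).
    apply: eq_integral => s _; rewrite /G/= AE indicE mem_setE in_itv/= -EFinM.
    by rewrite andbC ltr_pdivrMr// [(2 * s)%R]mulrC.
  have mi : measurable_fun setT (fun s : R => (\1_(`](N y / 2)%R, N y]%classic) s)%:E : \bar R).
    by apply/measurable_EFinP; exact: measurable_indic.
  have k0 : (0 <= 2 / N y)%R by rewrite divr_ge0// ltW.
  rewrite ge0_integralTZr//; last 2 first.
  - exact: measurable_funeM.
  - by move=> s; rewrite mule_ge0 ?lee_fin.
  rewrite ge0_integralTZl//.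
  have -> : \int[leb]_s (\1_(`](N y / 2)%R, N y]%classic) s)%:E = (N y / 2)%:E.
    transitivity (leb `](N y / 2)%R, N y]%classic).
      by rewrite integral_indic// setIT.
    rewrite lebesgue_measure_itv/= lte_fin ltr_pdivrMr// ltr_pMr// ltr1n.
    by rewrite -EFinB; congr EFin; lra.
  rewrite -EFinM (_ : _ * _ = 1)%R ?mul1e//.
  by field; rewrite gt_eqF.
have m1 : measurable_fun setT (fun x => \int[leb]_y G (x, y)).
  exact: measurable_fun_fubini_tonelli_F.
(* At y = 0 no scale s qualifies and the inner integral is 0 instead of [h 0]; this is a single null
   point. *)
apply: ge0_ae_eq_integral => //.
- by move=> x _; exact: integral_ge0.
- exists [set 0%R]; split; [exact: measurable_rV_set1|exact: lebesgue_rV_set1|].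
  by move=> y /=; apply: contra_notP => /eqP y0 _; exact: GE.
Qed.

End polar_integrand.
End polar.

Section polar_consequences.
Context {R : realType} {n : nat}.
Notation leb := (@lebesgue_measure R).
Notation vol := (@lebesgue_rV R n.+1).
Variable N : 'rV[R]_n.+1 -> R.
Hypothesis N_norm : is_norm N.
Local Open Scope ereal_scope.
Notation rw := (@radial_weight R n).

Definition direction_mass : \bar R := \int[vol]_x (direction_weight N x)%:E.

Lemma direction_weight_neq0 x : direction_weight N x != 0%R -> (0 < N x)%R.
Proof.
rewrite /direction_weight shellE.
have [/andP[x1 _] _|_] := boolP (1 <= N x < 2)%R; first exact: lt_le_trans x1.
by rewrite mulr0 mul0r eqxx.
Qed.

Lemma direction_weight0Vgt0 x : direction_weight N x = 0%R \/ (0 < N x)%R.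
Proof. by have [|/direction_weight_neq0] := eqVneq (direction_weight N x) 0%R; [left|right]. Qed.

Lemma eq_radial (f g : R -> \bar R) : (forall r, (0 < r)%R -> f r = g r) ->
  \int[leb]_r ((rw r)%:E * f r) = \int[leb]_r ((rw r)%:E * g r).
Proof.
move=> fg; apply: eq_integral => r _; have [r0|r0] := ltP 0%R r; first by rewrite fg.
by rewrite /radial_weight indicE mem_setE in_itv/= andbT ltNge r0 mul0r !mul0e.
Qed.

Lemma is_norm_ray x (r : R) : (0 < N x)%R -> N ((r / N x) *: x)%R = `|r|%R.
Proof.
move=> x0; rewrite (is_normZ N_norm) normrM normfV (gtr0_norm x0).
by rewrite mulfVK// gt_eqF.
Qed.

Lemma radial_integral (psi : R -> \bar R) :
  measurable_fun setT psi -> (forall r, 0 <= psi r) ->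
  \int[vol]_x psi (N x) = direction_mass * \int[leb]_r ((rw r)%:E * psi r).
Proof.
move=> mpsi psi0.
have mh : measurable_fun setT (psi \o N).
  by apply: measurableT_comp => //; exact: measurable_is_norm.
rewrite [LHS](polar_integral N_norm mh (fun x => psi0 (N x))).
have I0 : 0 <= \int[leb]_r ((rw r)%:E * psi r).
  by apply: integral_ge0 => r _; rewrite mule_ge0// lee_fin radial_weight_ge0.
have md : measurable_fun setT (fun x => (direction_weight N x)%:E).
  by apply/measurable_EFinP; exact: measurable_direction_weight.
have d0 x : 0 <= (direction_weight N x)%:E.
  by rewrite lee_fin direction_weight_ge0.
apply: (etrans _ (ge0_integralTZr vol md d0 I0)).
apply: eq_integral => x _; have [->|x0] := direction_weight0Vgt0 x.
  by rewrite !mul0e.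
congr (_ * _); apply: eq_radial => r r0 /=.
by rewrite is_norm_ray// gtr0_norm.
Qed.

(** If it vanished, [radial_integral] for the constant 1 would give the whole space volume 0, but
    the unit cube has volume 1. *)
Lemma direction_mass_gt0 : 0 < direction_mass.
Proof.
rewrite lt_neqAle eq_sym; apply/andP; split; last first.
  by apply: integral_ge0 => x _; rewrite lee_fin direction_weight_ge0.
apply/eqP => D0.
have := radial_integral (measurable_cst (1 : \bar R)) (fun=> lee01).
rewrite D0 mul0e integral_cst// mul1e => v0.
have : vol [set x | forall i, `[0%R, 1%R]%classic (x ord0 i)] <= vol setT.
  apply: le_measure; rewrite ?inE//.
  by apply: (measurable_box (A := fun=> `[0%R, 1%R]%classic)).
rewrite [X in _ <= X]v0 (lebesgue_rV_box (A := fun=> `[0%R, 1%R]%classic))//.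
rewrite big1; first by rewrite leNgt lte01.
by move=> i _; rewrite lebesgue_measure_itv/= lte01 sube0.
Qed.

(** The weight is at most 2 on the shell, and the shell lies in a box. *)
Lemma direction_mass_lty : direction_mass < +oo.
Proof.
have [c c0 Nc] := is_norm_ge_sup N_norm isT.
pose B := [set x : 'rV[R]_n.+1 | forall i, `[(- (2 / c))%R, (2 / c)%R]%classic (x ord0 i)].
have mB : measurable B by apply: (measurable_box (A := fun=> `[(- (2 / c))%R, (2 / c)%R]%classic)).
have vB : vol B < +oo.
  rewrite (lebesgue_rV_box (A := fun=> `[(- (2 / c))%R, (2 / c)%R]%classic))//.
  have -> : leb `[(- (2 / c))%R, (2 / c)%R]%classic = (2 / c - - (2 / c))%:E.
    rewrite lebesgue_measure_itv/= lte_fin ifT ?EFinB//.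
    have : (0 < 2 / c)%R by rewrite divr_gt0.
    by move=> ?; lra.
  by rewrite prodEFin ltry.
have mI : measurable_fun setT (fun x => (\1_B x : R)%:E).
  by apply/measurable_EFinP; exact: measurable_indic.
have I0 x : 0 <= (\1_B x : R)%:E by rewrite lee_fin.
apply: (@le_lt_trans _ _ (\int[vol]_x (2%:E * (\1_B x)%:E))).
  apply: ge0_le_integralT.
  - by apply/measurable_EFinP; exact: measurable_direction_weight.
  - exact: measurable_funeM.
  - by move=> x; rewrite lee_fin direction_weight_ge0.
  move=> x; rewrite -EFinM lee_fin /direction_weight shellE.
  have [/andP[x1 x2]|_] := boolP (1 <= N x < 2)%R; last by rewrite mulr0 mul0r mulr_ge0.
  rewrite indicE mem_set ?mulr1.
    rewrite ler_pdivrMr ?exprn_gt0//; last exact: lt_le_trans x1.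
    by rewrite ler_peMr// exprn_ege1.
  move=> i /=; rewrite in_itv/= -ler_norml (le_trans (normr_coord_le x i))//.
  by rewrite ler_pdivlMr// mulrC (le_trans (Nc x))// ltW.
rewrite (ge0_integralTZl vol mI I0 (ler0n R 2)).
by rewrite integral_indic// setIT lte_mul_pinfty// lee_fin.
Qed.

Lemma direction_mass_fin_num : direction_mass \is a fin_num.
Proof. by rewrite ge0_fin_numE ?direction_mass_lty// ltW// direction_mass_gt0. Qed.

Lemma polar_le (h1 h2 : 'rV[R]_n.+1 -> \bar R) :
  measurable_fun setT h1 -> measurable_fun setT h2 ->
  (forall x, 0 <= h1 x) -> (forall x, 0 <= h2 x) ->
  (forall x, (0 < N x)%R -> ray_integral N h1 x <= ray_integral N h2 x) ->
  \int[vol]_x h1 x <= \int[vol]_x h2 x.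
Proof.
move=> m1 m2 h10 h20 h12; rewrite (polar_integral N_norm m1 h10) (polar_integral N_norm m2 h20).
apply: ge0_le_integralT; try exact: measurable_ray_integral.
  move=> x; rewrite mule_ge0 ?lee_fin ?direction_weight_ge0//.
  by apply: integral_ge0 => r _; rewrite mule_ge0// lee_fin radial_weight_ge0.
move=> x; have [->|x0] := direction_weight0Vgt0 x; first by rewrite !mul0e.
by rewrite lee_wpmul2l ?lee_fin ?direction_weight_ge0 ?h12.
Qed.

End polar_consequences.

(** * The cost of the staircases as a function of gamma *)

Section staircase_cost.
Context {R : realType} {n : nat}.
Notation leb := (@lebesgue_measure R).
Variables (epsilon Delta : R).
Hypothesis epsilon_gt0 : 0 < epsilon.
Hypothesis Delta_gt0 : 0 < Delta.
Notation rw := (@radial_weight R n).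

Definition radial_stair (gamma r : R) := stair epsilon (r / Delta + 1 - gamma).

Lemma radial_stair_ge0 gamma r : 0 <= radial_stair gamma r.
Proof. exact: stair_ge0. Qed.

Lemma radial_stair_gt0 gamma r : 0 < radial_stair gamma r.
Proof. exact: stair_gt0. Qed.

Lemma le_radial_stair gamma gamma' r : gamma <= gamma' ->
  radial_stair gamma r <= radial_stair gamma' r.
Proof. by move=> gg; apply: le_stair => //; rewrite lerD2l lerN2. Qed.

Lemma measurable_radial_stair gamma : measurable_fun setT (radial_stair gamma).
Proof.
apply: measurableT_comp; first exact: measurable_stair.
by apply: measurable_funB => //; apply: measurable_funD => //; apply: measurable_funM.
Qed.

(** Lowering gamma raises the argument of [stair], so right-continuity gives convergence at every r
    as gamma increases to its limit. From the other side, integer arguments must be excluded. *)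
Lemma near_stair_right (y : R) : \forall i \near \oo, stair epsilon (y + i.+1%:R^-1) = stair epsilon y.
Proof.
have /andP[y1 y2] := floor_itv y.
have e0 : 0 < (Num.floor y + 1)%:~R - y by rewrite subr_gt0.
near=> i; rewrite /stair (_ : Num.floor _ = Num.floor y)//; apply: floor_def.
have ie : i.+1%:R^-1 < (Num.floor y + 1)%:~R - y.
  by near: i; exact: (near_infty_natSinv_lt (PosNum e0)).
have i0 : (0 : R) < i.+1%:R^-1 by rewrite invr_gt0.
move: i.+1%:R^-1 ie i0 => e ie i0; rewrite intrD in y2 ie *.
by apply/andP; split; lra.
Unshelve. all: by end_near. Qed.

Lemma near_stair_left (y : R) : (forall k : int, y != k%:~R) ->
  \forall i \near \oo, stair epsilon (y - i.+1%:R^-1) = stair epsilon y.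
Proof.
move=> yZ; have /andP[y1 y2] := floor_itv y.
have e0 : 0 < y - (Num.floor y)%:~R by rewrite subr_gt0 lt_neqAle eq_sym yZ.
near=> i; rewrite /stair (_ : Num.floor _ = Num.floor y)//; apply: floor_def.
have ie : i.+1%:R^-1 < y - (Num.floor y)%:~R.
  by near: i; exact: (near_infty_natSinv_lt (PosNum e0)).
have i0 : (0 : R) < i.+1%:R^-1 by rewrite invr_gt0.
move: i.+1%:R^-1 ie i0 => e ie i0; rewrite intrD in y2 *.
by apply/andP; split; lra.
Unshelve. all: by end_near. Qed.

Local Open Scope ereal_scope.

Definition stair_mass (gamma : R) : \bar R :=
  \int[leb]_r (rw r * radial_stair gamma r)%:E.

Lemma measurable_rw_stair gamma :
  measurable_fun setT (fun r => (rw r * radial_stair gamma r)%:E).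
Proof.
apply/measurable_EFinP; apply: measurable_funM; first exact: measurable_radial_weight.
exact: measurable_radial_stair.
Qed.

Lemma rw_stair_ge0 gamma r : (0 <= rw r * radial_stair gamma r)%R.
Proof. by rewrite mulr_ge0 ?radial_weight_ge0 ?radial_stair_ge0. Qed.

Lemma stair_mass_ge0 gamma : 0 <= stair_mass gamma.
Proof. by apply: integral_ge0 => r _; rewrite lee_fin rw_stair_ge0. Qed.

Lemma le_stair_mass gamma gamma' : (gamma <= gamma')%R -> stair_mass gamma <= stair_mass gamma'.
Proof.
move=> gg; apply: ge0_le_integralT => [||r|r]; try exact: measurable_rw_stair.
  by rewrite lee_fin rw_stair_ge0.
by rewrite lee_fin ler_wpM2l ?radial_weight_ge0 ?le_radial_stair.
Qed.

Lemma stair_mass_lty gamma : stair_mass gamma < +oo.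
Proof.
(* Half the decay rate epsilon / Delta: the other half absorbs the polynomial factor. *)
pose c := (epsilon / (2 * Delta))%R.
have c0 : (0 < c)%R by rewrite divr_gt0// mulr_gt0.
have cge0 := ltW c0.
have n1 : n.+1%:R != 0%R :> R by rewrite pnatr_eq0.
have nc0 : (0 <= n.+1%:R / c)%R by exact: divr_ge0.
pose K := ((n.+1%:R / c) ^+ n * expR (epsilon * gamma))%R.
have K0 : (0 <= K)%R by rewrite mulr_ge0 ?expR_ge0 ?exprn_ge0.
have bound r : (rw r * radial_stair gamma r <= K / c * exponential_pdf c r)%R.
  rewrite /radial_weight indicE mem_setE in_itv/= andbT.
  have [r0|r0] := ltP 0%R r; last first.
    rewrite !mul0r; apply: mulr_ge0; first exact: divr_ge0.
    exact: exponential_pdf_ge0.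
  rewrite mul1r (exponential_pdfE _ (ltW r0)) mulrA divfK ?gt_eqF//.
  (* From u <= expR u at u = c r / (n + 1); dividing by n + 1 instead of n also covers n = 0. *)
  have rn : (r ^+ n <= (n.+1%:R / c) ^+ n * expR (c * r))%R.
    pose u := (c * r / n.+1%:R)%R.
    have u0 : (0 <= u)%R by rewrite divr_ge0// mulr_ge0// ltW.
    have cr : (c * r = n.+1%:R * u)%R by rewrite /u mulrCA divff// mulr1.
    have -> : (r ^+ n = (n.+1%:R / c) ^+ n * u ^+ n)%R.
      by rewrite -exprMn mulrAC -cr mulrAC mulfV ?mul1r// gt_eqF.
    apply: ler_wpM2l; first exact: exprn_ge0.
    rewrite cr expRM_natl.
    have ue : (u <= expR u)%R by rewrite (le_trans _ (expR_ge1Dx u))// lerDr.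
    apply: (@le_trans _ _ (expR u ^+ n)%R); first by rewrite lerXn2r ?nnegrE ?expR_ge0.
    by rewrite [leRHS]exprS ler_peMl ?exprn_ge0 ?expR_ge0// -expR0 ler_expR.
  have sr : (radial_stair gamma r <= expR (epsilon * gamma) * expR (- (2 * c) * r))%R.
    rewrite -expRD ler_expR.
    have := floorD1_gt (r / Delta + 1 - gamma)%R.
    rewrite intrD -(ltr_pM2r epsilon_gt0) => H.
    have -> : (epsilon * gamma + - (2 * c) * r = - (r / Delta - gamma) * epsilon)%R.
      by rewrite /c; field; rewrite gt_eqF.
    by rewrite !mulNr lerN2; lra.
  have rn0 : (0 <= r ^+ n)%R by rewrite exprn_ge0// ltW.
  apply: (le_trans (ler_pM rn0 (radial_stair_ge0 gamma r) rn sr)).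
  rewrite /K mulrACA -!mulrA ler_wpM2l ?exprn_ge0//.
  rewrite ler_wpM2l ?expR_ge0// -expRD ler_expR.
  rewrite [X in (X + _)%R](_ : _ = c * r)%R; last by rewrite /c mulrA.
  by rewrite (_ : c * r + - (2 * c) * r = - c * r)%R//; ring.
apply: (@le_lt_trans _ _ (\int[leb]_r ((K / c)%:E * (exponential_pdf c r)%:E))).
  apply: ge0_le_integralT.
  - exact: measurable_rw_stair.
  - apply: measurable_funeM; apply/measurable_EFinP.
    exact: measurable_exponential_pdf.
  - by move=> r; rewrite lee_fin rw_stair_ge0.
  - by move=> r; rewrite -EFinM lee_fin.
rewrite ge0_integralTZl; first by rewrite integral_exponential_pdf// mule1 ltry.
- by apply/measurable_EFinP; exact: measurable_exponential_pdf.
- by move=> r; rewrite lee_fin exponential_pdf_ge0.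
- exact: divr_ge0.
Qed.

Lemma stair_mass_gt0 gamma : 0 < stair_mass gamma.
Proof.
pose b := radial_stair gamma 2.
have b0 : (0 < b)%R by exact: radial_stair_gt0.
have m1 : measurable_fun setT (fun r : R => (\1_(`]1%R, 2%R]%classic) r)%:E : \bar R).
  by apply/measurable_EFinP; exact: measurable_indic.
apply: (@lt_le_trans _ _ (\int[leb]_r (b%:E * (\1_(`]1%R, 2%R]%classic) r)%:E))).
  have i0 (r : R) : 0 <= ((\1_(`]1%R, 2%R]%classic) r)%:E : \bar R) by rewrite lee_fin.
  rewrite [ltRHS](ge0_integralTZl leb m1 i0 (ltW b0)).
  rewrite mule_gt0 ?lte_fin//.
  have -> : \int[leb]_r (\1_(`]1%R, 2%R]%classic) r)%:E = leb `]1%R, 2%R]%classic.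
    by rewrite integral_indic// setIT.
  by rewrite lebesgue_measure_itv/= lte_fin ltr1n -EFinB lte_fin subr_gt0 ltr1n.
apply: ge0_le_integralT.
- exact: measurable_funeM.
- exact: measurable_rw_stair.
- by move=> r; rewrite mule_ge0 ?lee_fin// ltW.
move=> r; rewrite -EFinM lee_fin indicE mem_setE in_itv/=.
have [/andP[r1 r2]|_] := boolP (1 < r <= 2)%R; last by rewrite mulr0 rw_stair_ge0.
have r0 : (0 < r)%R by exact: lt_trans r1.
rewrite mulr1 /radial_weight indicE mem_setE in_itv/= andbT r0 mul1r.
apply: (@le_trans _ _ (radial_stair gamma r)).
  by apply: le_stair => //; rewrite lerB// lerD2r ler_wpM2r// invr_ge0 ltW.
by rewrite ler_peMl ?radial_stair_ge0// exprn_ege1// ltW.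
Qed.

Lemma stair_mass_fin_num gamma : stair_mass gamma \is a fin_num.
Proof. by rewrite ge0_fin_numE ?stair_mass_lty ?stair_mass_ge0. Qed.

Lemma fine_stair_mass_gt0 gamma : (0 < fine (stair_mass gamma))%R.
Proof. by rewrite fine_gt0// stair_mass_gt0 stair_mass_lty. Qed.

(** Dominated convergence, with the integrand for gamma + 1 as bound; pointwise convergence fails at
    most at the countably many r with an integer argument. *)
Lemma cvg_stair_mass gamma :
  stair_mass (gamma + i.+1%:R^-1)%R @[i --> \oo] --> stair_mass gamma.
Proof.
have i1 (i : nat) : (i.+1%:R^-1 <= 1 :> R)%R by rewrite invf_le1// ler1n.
pose f_ (i : nat) (r : R) := (rw r * radial_stair (gamma + i.+1%:R^-1) r)%:E.
pose f (r : R) := (rw r * radial_stair gamma r)%:E.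
pose g (r : R) := (rw r * radial_stair (gamma + 1) r)%:E.
have mf_ i : measurable_fun setT (f_ i) by exact: measurable_rw_stair.
have mf : measurable_fun setT f by exact: measurable_rw_stair.
have ig : leb.-integrable setT g.
  apply/integrableP; split; first exact: measurable_rw_stair.
  rewrite (_ : \int[leb]_r `|g r| = stair_mass (gamma + 1)) ?stair_mass_lty//.
  by apply: eq_integral => r _; rewrite gee0_abs// lee_fin rw_stair_ge0.
have f_g : {ae leb, forall r (i : nat), setT r -> `|f_ i r| <= g r}.
  apply: aeW => r i _; rewrite gee0_abs ?lee_fin ?rw_stair_ge0//.
  by rewrite ler_wpM2l ?radial_weight_ge0// le_radial_stair// lerD2l.
have f_f : {ae leb, forall r, setT r -> f_ ^~ r @ \oo --> f r}.
  pose E := range (fun k : int => (k%:~R - 1 + gamma) * Delta)%R.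
  have cE : countable E by exact: sub_countable (card_image_le _ _) (countableP _).
  exists E; split.
  - exact: countable_measurable.
  - exact: countable_lebesgue_measure0.
  move=> r /=; apply: contra_notP => rE _.
  have yZ (k : int) : (r / Delta + 1 - gamma)%R != k%:~R.
    apply/eqP => rk; apply: rE; exists k => //.
    by rewrite -rk; field; rewrite gt_eqF.
  apply: cvg_near_cst; near=> i; rewrite /f_ /f /radial_stair opprD addrA.
  by rewrite (near (near_stair_left yZ) i).
have [_ _] := @dominated_convergence _ (measurableTypeR R) R leb setT
  measurableT f_ f g mf_ mf f_f ig f_g.
exact.
Unshelve. all: by end_near. Qed.

Variable phi : R -> \bar R.
Hypothesis phi_ge0 : forall r, 0 <= phi r.
Hypothesis phi_nd : forall r s, (r <= s)%R -> phi r <= phi s.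

Definition stair_cost (gamma : R) : \bar R :=
  \int[leb]_r ((rw r * radial_stair gamma r)%:E * phi r).

Lemma measurable_rw_stair_phi gamma :
  measurable_fun setT (fun r => (rw r * radial_stair gamma r)%:E * phi r).
Proof.
apply: emeasurable_funM; first exact: measurable_rw_stair.
exact: nondecreasing_emeasurable.
Qed.

Lemma rw_stair_phi_ge0 gamma r : 0 <= (rw r * radial_stair gamma r)%:E * phi r.
Proof. by rewrite mule_ge0// lee_fin rw_stair_ge0. Qed.

Lemma le_rw_stair_phi gamma gamma' r : (gamma <= gamma')%R ->
  (rw r * radial_stair gamma r)%:E * phi r <= (rw r * radial_stair gamma' r)%:E * phi r.
Proof.
move=> gg; rewrite lee_wpmul2r// lee_fin.
by rewrite ler_wpM2l ?radial_weight_ge0 ?le_radial_stair.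
Qed.

Lemma stair_cost_ge0 gamma : 0 <= stair_cost gamma.
Proof. by apply: integral_ge0 => r _; exact: rw_stair_phi_ge0. Qed.

Lemma le_stair_cost gamma gamma' : (gamma <= gamma')%R ->
  stair_cost gamma <= stair_cost gamma'.
Proof.
move=> gg; apply: ge0_le_integralT => [||r|r]; try exact: measurable_rw_stair_phi.
  exact: rw_stair_phi_ge0.
exact: le_rw_stair_phi.
Qed.

(** The cost may be infinite, so there is no integrable bound. Approaching gamma from below makes
    the integrands increase, and monotone convergence applies. *)
Lemma cvg_stair_cost gamma :
  stair_cost (gamma - i.+1%:R^-1)%R @[i --> \oo] --> stair_cost gamma.
Proof.
pose g (i : nat) (r : R) := (rw r * radial_stair (gamma - i.+1%:R^-1) r)%:E * phi r.
have mg i : measurable_fun setT (g i) by exact: measurable_rw_stair_phi.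
have g0 i r : setT r -> 0 <= g i r by move=> _; exact: rw_stair_phi_ge0.
have ndg r : setT r -> {homo g ^~ r : i j / (i <= j)%N >-> i <= j}.
  move=> _ i j ij; apply: le_rw_stair_phi.
  by rewrite lerD2l lerN2 lef_pV2 ?posrE// ler_nat ltnS.
have -> : stair_cost gamma = \int[leb]_r limn (g ^~ r).
  apply: eq_integral => r _; apply/esym/cvg_lim => //.
  apply: cvg_near_cst; near=> i; rewrite /g /radial_stair opprB addrCA addrC.
  by rewrite (near (near_stair_right _) i).
exact: cvg_monotone_convergence.
Unshelve. all: by end_near. Qed.

(** The cost of the normalised staircase; the mass of the directions cancels between numerator and
    denominator. *)
Definition mean_cost (gamma : R) : \bar R :=
  stair_cost gamma * (fine (stair_mass gamma))^-1%:E.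

Lemma le_mean_costE (M gamma : R) :
  (M%:E <= mean_cost gamma) = (M%:E * stair_mass gamma <= stair_cost gamma).
Proof.
by rewrite /mean_cost lee_pdivlMr ?fine_stair_mass_gt0// fineK ?stair_mass_fin_num.
Qed.

Lemma lt_mean_costE (M gamma : R) :
  (M%:E < mean_cost gamma) = (M%:E * stair_mass gamma < stair_cost gamma).
Proof.
by rewrite /mean_cost lte_pdivlMr ?fine_stair_mass_gt0// fineK ?stair_mass_fin_num.
Qed.

Lemma mean_cost_ge0 gamma : 0 <= mean_cost gamma.
Proof.
by rewrite mule_ge0 ?stair_cost_ge0// lee_fin invr_ge0 ltW ?fine_stair_mass_gt0.
Qed.

Lemma lte_between (a : R) (y : \bar R) : a%:E < y ->
  exists2 b : R, (a < b)%R & b%:E < y.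
Proof.
case: y => [y| |] //; rewrite ?lte_fin => ay; last by exists (a + 1)%R; rewrite ?ltrDl ?ltry.
by exists ((a + y) / 2)%R; rewrite ?lte_fin; lra.
Qed.

(** Mass and cost both increase with gamma, so within e of gamma the mass is at most its value at
    gamma + e and the cost at least its value at gamma - e. The one-sided limits above therefore
    suffice. *)
Lemma mean_cost_lsc (M gamma : R) : (0 <= M)%R -> M%:E < mean_cost gamma ->
  \forall gamma' \near gamma, M%:E <= mean_cost gamma'.
Proof.
move=> M0; rewrite lt_mean_costE => MJ.
have [A MA AJ] : exists2 A, M%:E * stair_mass gamma < A & A < stair_cost gamma.
  have Mfin : M%:E * stair_mass gamma \is a fin_num.
    by rewrite fin_numM ?stair_mass_fin_num.
  move: MJ; rewrite -(fineK Mfin) => /lte_between[A MA AJ].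
  by exists A%:E; rewrite ?lte_fin.
have cM : M%:E * stair_mass (gamma + i.+1%:R^-1)%R @[i --> \oo] --> M%:E * stair_mass gamma.
  by apply: cvgeZl => //; exact: cvg_stair_mass.
have nearM : \forall i \near \oo, M%:E * stair_mass (gamma + i.+1%:R^-1)%R < A.
  exact: (cM _ (open_ereal_lt' MA)).
have nearJ : \forall i \near \oo, A < stair_cost (gamma - i.+1%:R^-1)%R.
  exact: (@cvg_stair_cost gamma _ (open_ereal_gt' AJ)).
have [i [Mi Ji]] : exists i : nat, M%:E * stair_mass (gamma + i.+1%:R^-1)%R < A /\
    A < stair_cost (gamma - i.+1%:R^-1)%R.
  near \oo => i; exists i; split; near: i; [exact: nearM|exact: nearJ].
have i0 : (0 < i.+1%:R^-1 :> R)%R by rewrite invr_gt0.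
near=> g; have : (`|gamma - g| < i.+1%:R^-1)%R.
  near: g; exact: nbhsx_ballx.
rewrite ltr_distlC => /andP[/ltW g1 /ltW g2]; rewrite le_mean_costE.
apply: (@le_trans _ _ (M%:E * stair_mass (gamma + i.+1%:R^-1)%R)).
  by apply: lee_wpmul2l; [rewrite lee_fin|exact: le_stair_mass].
apply: (le_trans (ltW Mi)); apply: (le_trans (ltW Ji)).
exact: le_stair_cost.
Unshelve. all: by end_near. Qed.

(** If the infimum m were not attained, lower semicontinuity and compactness of [0, 1] would bound
    all costs below by m + 1 / (i + 1) for a single i. *)
Lemma exists_min_mean_cost : exists2 gamma, (0 <= gamma <= 1)%R &
  forall gamma', (0 <= gamma' <= 1)%R -> mean_cost gamma <= mean_cost gamma'.
Proof.
pose m := ereal_inf [set mean_cost g | g in `[0%R, 1%R]%classic].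
have mle g : (0 <= g <= 1)%R -> m <= mean_cost g.
  by move=> g01; apply: ereal_inf_lbound; exists g.
suff [g g01 gm] : exists2 g, (0 <= g <= 1)%R & mean_cost g <= m.
  by exists g; [exact: g01|move=> g' g'01; exact: (le_trans gm (mle g' g'01))].
apply: contrapT => nomin.
have mlt g : (0 <= g <= 1)%R -> m < mean_cost g.
  by move=> g01; rewrite ltNge; apply/negP => gm; apply: nomin; exists g.
have m0 : 0 <= m by apply: le_ereal_inf_tmp => _ [g _ <-]; exact: mean_cost_ge0.
have mfin : m \is a fin_num.
  by rewrite ge0_fin_numE// (lt_le_trans (mlt 0%R _)) ?leey ?lexx ?ler01.
have mE := fineK mfin; set a := fine m in mE.
have a0 : (0 <= a)%R by exact: fine_ge0.
have /compact_near_coveringP cov := @segment_compact R 0%R 1%R.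
pose P (i : nat) (g : R) := (a + i.+1%:R^-1)%:E <= mean_cost g.
have [i iP] : exists i, `[0%R, 1%R]%classic `<=` P i.
  have := cov nat \oo P _; case; last by move=> i _ iP; exists i; exact: (iP i (leqnn i)).
  move=> g /=; rewrite in_itv/= => /mlt; rewrite -mE => /lte_between[A aA Ag].
  have A0 : (0 <= A)%R by rewrite (le_trans a0)// ltW.
  have e0 : (0 < A - a)%R by rewrite subr_gt0.
  exists ([set g' | A%:E <= mean_cost g'], [set i | i.+1%:R^-1 < A - a]%R).
    split; first exact: mean_cost_lsc.
    exact: (near_infty_natSinv_lt (PosNum e0)).
  move=> [g' i] /= [Ag' iA]; apply: (le_trans _ Ag').
  by rewrite lee_fin -lerBrDl ltW.
have : (a + i.+1%:R^-1)%:E <= m.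
  by apply: le_ereal_inf_tmp => _ [g g01 <-]; exact: iP.
by rewrite -mE lee_fin leNgt ltrDl invr_gt0 ltr0n.
Qed.

End staircase_cost.

(** * Measures with a density *)

Section density.
Context d (T : measurableType d) {R : realType}.
Variable mu : {measure set T -> \bar R}.
Local Open Scope ereal_scope.
Import HBNNSimple.

Lemma ge0_integral_density (nu : {measure set T -> \bar R}) (f : T -> R) (g : T -> \bar R) :
  measurable_fun setT f -> (forall x, (0 <= f x)%R) ->
  (forall A, measurable A -> nu A = \int[mu]_(x in A) (f x)%:E) ->
  measurable_fun setT g -> (forall x, 0 <= g x) ->
  \int[nu]_x g x = \int[mu]_x (g x * (f x)%:E).
Proof.
move=> mf f0 nuE mg g0.
have mEf : measurable_fun setT (EFin \o f) by exact/measurable_EFinP.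
pose g_ := nnsfun_approx measurableT mg.
have ndg x : {homo (fun i => (g_ i x)%:E) : i j / (i <= j)%N >-> i <= j}.
  by move=> i j ij; rewrite lee_fin; exact/lefP/nd_nnsfun_approx.
have cvgg x : (g_ i x)%:E @[i --> \oo] --> g x.
  by apply: cvg_nnsfun_approx.
have simple (h : {nnsfun T >-> R}) :
    \int[nu]_x (h x)%:E = \int[mu]_x ((h x)%:E * (f x)%:E).
  have indic r : \int[nu]_x (r * \1_(h @^-1` [set r]) x)%:E =
      \int[mu]_x (r * \1_(h @^-1` [set r]) x * f x)%:E.
    (* A nonnegative simple function takes no negative value, so these level sets are empty. *)
    have [r0|r0] := ltP r 0%R.
      rewrite preimage_nnfun0//.
      by rewrite !integral0_eq// => x _; rewrite indic0 mulr0 ?mul0r.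
    have mA : measurable (h @^-1` [set r]) by exact: measurable_sfunP.
    transitivity (r%:E * nu (h @^-1` [set r])).
      rewrite -[X in _ * nu X]setIT -integral_indic// -ge0_integralTZl//.
      by apply/measurable_EFinP; exact: measurable_indic.
    rewrite nuE// integral_mkcond -ge0_integralTZl//.
    - apply: eq_integral => x _; rewrite patchE indicE.
      by case: ifPn => _ /=; rewrite ?(mulr0, mulr1) ?mul0r ?mule0 ?EFinM.
    - by apply/measurable_restrict => //; exact: measurable_funTS.
    - by move=> x; rewrite patchE; case: ifPn; rewrite ?lee_fin.
  have rh0 r x : (0 <= r * \1_(h @^-1` [set r]) x)%R.
    by rewrite -lee_fin EFinM nnfun_muleindic_ge0.
  have mrh r : measurable_fun setT (fun x => r * \1_(h @^-1` [set r]) x)%R.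
    exact: measurable_funM.
  transitivity (\int[nu]_x \sum_(r \in range h) (r * \1_(h @^-1` [set r]) x)%:E).
    by apply: eq_integral => x _; rewrite fsumEFin// -fimfunE.
  transitivity (\int[mu]_x \sum_(r \in range h) (r * \1_(h @^-1` [set r]) x * f x)%:E).
    rewrite !ge0_integral_fsum//.
    - by apply: eq_fsbigr => r _; exact: indic.
    - by move=> r; apply/measurable_EFinP; exact: measurable_funM.
    - by move=> r x _; rewrite lee_fin mulr_ge0.
    - by move=> r; exact/measurable_EFinP.
    - by move=> r x _; rewrite lee_fin.
  apply: eq_integral => x _; rewrite fsumEFin//.
  by rewrite -mulr_fsuml// -fimfunE EFinM.
transitivity (limn (fun i => \int[nu]_x (g_ i x)%:E)).
  rewrite -monotone_convergence//.
  - by apply: eq_integral => x _; apply/esym/cvg_lim.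
  - by move=> i; exact/measurable_EFinP.
  - by move=> i x _; rewrite lee_fin.
under eq_fun do rewrite simple.
rewrite -monotone_convergence//.
- apply: eq_integral => x _; apply/cvg_lim => //.
  by apply: cvgeZr.
- by move=> i; apply: emeasurable_funM => //; exact/measurable_EFinP.
- by move=> i x _; rewrite mule_ge0 ?lee_fin.
- by move=> x _ i j ij; apply: lee_wpmul2r; [rewrite lee_fin|exact: ndg].
Qed.

Lemma density_probability (f : T -> R) :
  measurable_fun setT f -> (forall x, (0 <= f x)%R) ->
  \int[mu]_x (f x)%:E = 1 ->
  exists nu : probability T R,
    forall A, measurable A -> nu A = \int[mu]_(x in A) (f x)%:E.
Proof.
move=> mf f0 f1.
have mEf : measurable_fun setT (EFin \o f) by exact/measurable_EFinP.
pose nu (A : set T) : \bar R := \int[mu]_(x in A) (f x)%:E.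
have nu0 : nu set0 = 0 by rewrite /nu integral_set0.
have nu_ge0 A : 0 <= nu A by apply: integral_ge0 => x _; rewrite lee_fin.
have nuU : semi_sigma_additive nu.
  move=> /= F mF tF mUF; rewrite /nu ge0_integral_bigcup//.
  - apply: is_cvg_ereal_nneg_natsum_cond => i _ _; exact: nu_ge0.
  - exact: measurable_funTS.
  - by move=> x _; rewrite lee_fin.
pose m1 := isMeasure.Build _ _ _ nu nu0 nu_ge0 nuU.
pose nuM : measure T R := HB.pack nu m1.
pose nuP : probability T R := HB.pack nu m1 (Measure_isProbability.Build _ _ _ nuM f1).
by exists nuP.
Qed.

End density.

(** * The staircase mechanism *)

Section staircase_mechanism.
Context {R : realType} {n : nat}.
Notation vol := (@lebesgue_rV R n.+1).
Notation leb := (@lebesgue_measure R).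
Notation rw := (@radial_weight R n).
Variable N : 'rV[R]_n.+1 -> R.
Hypothesis N_norm : is_norm N.
Variables (epsilon Delta : R).
Hypothesis epsilon_gt0 : 0 < epsilon.
Hypothesis Delta_gt0 : 0 < Delta.
Notation rs := (radial_stair epsilon Delta).
Notation Z := (@stair_mass R n epsilon Delta).

(** The only nonzero term has index [j]; since gamma <= 1 this floor is nonnegative, hence a
    legitimate index of the series. *)
Lemma staircase_profileE gamma x : gamma <= 1 ->
  staircase_profile N Delta epsilon gamma x = rs gamma (N x).
Proof.
move=> gamma1; rewrite /staircase_profile.
set j := Num.floor (N x / Delta + 1 - gamma).
have j0 : 0 <= j.
  rewrite floor_ge0 -addrA addr_ge0 ?subr_ge0// divr_ge0 ?is_norm_ge0//; exact: ltW.
have jE : j = `|j|%N by rewrite gez0_abs.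
have /andP[j1 j2] := floor_itv (N x / Delta + 1 - gamma).
rewrite -/j in j1 j2.
have term k : expR (- (k%:R * epsilon)) *
    \1_(`[(k%:R - 1 + gamma) * Delta, (k%:R + gamma) * Delta[%classic) (N x) =
    if k == `|j|%N then rs gamma (N x) else 0.
  rewrite indicE mem_setE in_itv/= -ler_pdivlMr// -ltr_pdivrMr//.
  have -> : (k%:R - 1 + gamma <= N x / Delta < k%:R + gamma) = (j == k).
    by rewrite /j floor_eq intrD -pmulrn; congr andb; apply/idP/idP; lra.
  rewrite [in LHS]jE eqz_nat eq_sym; case: eqP => [->|_]; last by rewrite mulr0.
  by rewrite mulr1 /radial_stair /stair -/j [in RHS]jE -pmulrn mulNr.
apply/cvg_lim => //; apply: cvg_near_cst.
exists `|j|.+1 => // m /= jm; rewrite /series/=.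
under eq_bigr do rewrite term.
rewrite -big_mkcond/= big_mkord.
by rewrite (big_pred1 (Ordinal jm)).
Qed.

(** Moving outwards by Delta divides the profile by exactly [expR epsilon], and N y is at most N x +
    Delta. *)
Lemma le_radial_stair_dp gamma x y : N (x - y) <= Delta ->
  rs gamma (N x) <= expR epsilon * rs gamma (N y).
Proof.
move=> xy; have Nyx : N y <= N x + Delta.
  rewrite -lerBlDl (le_trans _ xy)// (le_trans (ler_norm _))//.
  by rewrite distrC is_norm_lipschitz.
have -> : rs gamma (N x) = expR epsilon * rs gamma (N x + Delta).
  rewrite /radial_stair mulrDl divff ?gt_eqF//.
  rewrite (_ : _ + 1 + 1 - gamma = N x / Delta + 1 - gamma + 1); last by ring.
  by rewrite stairD1 mulrCA -expRD subrr expR0 mulr1.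
rewrite ler_wpM2l ?expR_ge0//; apply: le_stair => //.
by rewrite lerD2r lerD2r ler_wpM2r// invr_ge0 ltW.
Qed.

Local Open Scope ereal_scope.

Lemma integral_staircase_profile gamma : (gamma <= 1)%R ->
  \int[vol]_x (staircase_profile N Delta epsilon gamma x)%:E =
  direction_mass N * Z gamma.
Proof.
move=> gamma1; under eq_integral do rewrite staircase_profileE//.
rewrite (radial_integral N_norm (psi := EFin \o rs gamma))//.
- by apply/measurable_EFinP; exact: measurable_radial_stair.
- by move=> r; rewrite lee_fin radial_stair_ge0.
Qed.

Lemma staircase_constE gamma : (gamma <= 1)%R ->
  staircase_const N Delta epsilon gamma =
  ((fine (direction_mass N))^-1 * (fine (Z gamma))^-1)%R.
Proof.
move=> gamma1; rewrite /staircase_const /Rintegral integral_staircase_profile//.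
by rewrite fineM ?direction_mass_fin_num ?stair_mass_fin_num// invfM.
Qed.

Let D_gt0 : (0 < fine (direction_mass N))%R.
Proof. by rewrite fine_gt0// direction_mass_gt0// direction_mass_lty. Qed.

Lemma staircase_const_gt0 gamma : (gamma <= 1)%R ->
  (0 < staircase_const N Delta epsilon gamma)%R.
Proof.
by move=> gamma1; rewrite staircase_constE// mulr_gt0// invr_gt0// fine_stair_mass_gt0.
Qed.

Lemma staircase_densityE gamma x : (gamma <= 1)%R ->
  staircase_density N Delta epsilon gamma x =
  (staircase_const N Delta epsilon gamma * rs gamma (N x))%R.
Proof. by move=> gamma1; rewrite /staircase_density staircase_profileE. Qed.

Lemma staircase_density_ge0 gamma x : (gamma <= 1)%R ->
  (0 <= staircase_density N Delta epsilon gamma x)%R.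
Proof.
move=> gamma1; rewrite staircase_densityE// mulr_ge0 ?radial_stair_ge0//.
exact/ltW/staircase_const_gt0.
Qed.

Lemma measurable_staircase_density gamma : (gamma <= 1)%R ->
  measurable_fun setT (staircase_density N Delta epsilon gamma).
Proof.
move=> gamma1; rewrite (_ : staircase_density N Delta epsilon gamma = fun x =>
  staircase_const N Delta epsilon gamma * rs gamma (N x))%R; last first.
  by apply/funext => x; rewrite staircase_densityE.
apply: measurable_funM => //; apply: measurableT_comp.
  exact: measurable_radial_stair.
exact: measurable_is_norm.
Qed.

Lemma integral_staircase_density (phi : R -> \bar R) gamma : (gamma <= 1)%R ->
  (forall r, 0 <= phi r) -> (forall r s, (r <= s)%R -> phi r <= phi s) ->
  \int[vol]_x (phi (N x) * (staircase_density N Delta epsilon gamma x)%:E) =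
  @mean_cost R n epsilon Delta phi gamma.
Proof.
move=> gamma1 phi0 phi_nd; set c := staircase_const N Delta epsilon gamma.
have mphi := nondecreasing_emeasurable phi_nd.
have c0 : (0 <= c)%R by exact/ltW/staircase_const_gt0.
pose psi r := (c%:E * ((rs gamma r)%:E * phi r)).
have mrs : measurable_fun setT (fun r => (rs gamma r)%:E * phi r).
  by apply: emeasurable_funM => //; apply/measurable_EFinP; exact: measurable_radial_stair.
have rs0 r : 0 <= (rs gamma r)%:E * phi r by rewrite mule_ge0// lee_fin radial_stair_ge0.
have mpsi : measurable_fun setT psi by exact: measurable_funeM.
have psi0 r : 0 <= psi r by rewrite mule_ge0.
transitivity (\int[vol]_x psi (N x)).
  apply: eq_integral => x _; rewrite staircase_densityE// /psi EFinM.
  by rewrite muleC muleA.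
rewrite (radial_integral N_norm mpsi psi0) /mean_cost /stair_cost.
transitivity (direction_mass N * (c%:E *
    \int[leb]_r ((rw r * rs gamma r)%:E * phi r))).
  congr (_ * _); rewrite -ge0_integralTZl//.
  - by apply: eq_integral => r _; rewrite /psi [LHS]muleCA; congr (_ * _); rewrite muleA -EFinM.
  - exact: measurable_rw_stair_phi.
  - by move=> r; exact: rw_stair_phi_ge0.
rewrite muleA -(fineK (direction_mass_fin_num N_norm)) -EFinM /c staircase_constE//.
by rewrite mulrA divff ?gt_eqF// mul1r muleC.
Qed.

(** A zero at x spreads along steps of norm at most Delta to every point, contradicting total mass
    1. *)
Lemma dp_density_gt0 (f : 'rV[R]_n.+1 -> R) :
  (forall x, 0 <= f x)%R ->
  (forall x y, N (x - y) <= Delta -> f x <= expR epsilon * f y)%R ->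
  \int[vol]_x (f x)%:E = 1 -> forall x, (0 < f x)%R.
Proof.
move=> f0 fdp f1 x; rewrite lt_neqAle f0 andbT eq_sym; apply/eqP => fx0.
have chain (v : 'rV[R]_n.+1) k : (N v <= Delta)%R -> f (x + k%:R *: v)%R = 0%R.
  move=> vD; elim: k => [|k IHk]; first by rewrite scale0r addr0.
  apply/eqP; rewrite eq_le f0 andbT -[leRHS](mulr0 (expR epsilon)) -IHk.
  by apply: fdp; rewrite -natr1 scalerDl scale1r opprD addrACA subrr add0r addrAC subrr add0r.
have f00 y : f y = 0%R.
  pose k := (Num.truncn (N (y - x) / Delta)%R).+1.
  have k0 : (0 < k%:R :> R)%R by rewrite ltr0n.
  have -> : y = (x + k%:R *: (k%:R^-1 *: (y - x)))%R.
    by rewrite scalerA mulfV ?gt_eqF// scale1r addrC subrK.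
  apply: chain; rewrite (is_normZ N_norm) normfV (gtr0_norm k0).
  rewrite mulrC ler_pdivrMr// mulrC -ler_pdivrMr//.
  by rewrite ltW// truncnS_gt.
have : \int[vol]_x (f x)%:E = 0 by apply: integral0_eq => y _; rewrite f00.
by rewrite f1 => -[] /eqP; rewrite oner_eq0.
Qed.

(** * Lower bound for an arbitrary private noise law *)

Section lower_bound.
Variable phi : R -> \bar R.
Hypothesis phi0 : forall r, 0 <= phi r.
Hypothesis phi_nd : forall r s, (r <= s)%R -> phi r <= phi s.
Notation mean := (@mean_cost R n epsilon Delta phi).

Lemma dp_noise_ge (nu : probability 'rV[R]_n.+1 R) (M : R) :
  dp_noise N Delta epsilon nu -> (0 <= M)%R ->
  (forall gamma, (0 <= gamma <= 1)%R -> M%:E < mean gamma) ->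
  M%:E <= \int[nu]_x phi (N x).
Proof.
move=> [_ [f [mf f0 nuE] fdp]] M0 Mlt.
have mphi := nondecreasing_emeasurable phi_nd.
have mN := measurable_is_norm N_norm.
have mphiN : measurable_fun setT (phi \o N) by exact: measurableT_comp.
have mEf : measurable_fun setT (EFin \o f) by exact/measurable_EFinP.
have f1 : \int[vol]_x (f x)%:E = 1 by rewrite -nuE// probability_setT.
have fgt0 := dp_density_gt0 f0 fdp f1.
rewrite (ge0_integral_density mf f0 nuE mphiN (fun x => phi0 (N x))).
have -> : M%:E = \int[vol]_x ((f x)%:E * M%:E).
  by rewrite (ge0_integralTZr vol mEf)// ?f1 ?mul1e// => x; rewrite lee_fin.
have mh1 : measurable_fun setT (fun x => (f x)%:E * M%:E) by exact: emeasurable_funM.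
have mh2 : measurable_fun setT (fun x => phi (N x) * (f x)%:E).
  exact: emeasurable_funM.
apply: (polar_le N_norm mh1 mh2) => [x|x|x Nx0].
- by rewrite mule_ge0 ?lee_fin.
- by rewrite mule_ge0 ?lee_fin.
(* The radial weight lives on r > 0, so the absolute value does not change the ray integrals, and it
   preserves the privacy bound on the whole line. *)
pose g (r : R) : R := f ((`|r| / N x) *: x)%R.
have g0 r : (0 <= g r)%R by exact: f0.
have gE (u : R -> \bar R) : \int[leb]_r ((rw r)%:E * ((g r)%:E * u r)) =
    \int[leb]_r ((rw r * g r)%:E * u r).
  by apply: eq_integral => r _; rewrite EFinM muleA.
have -> : ray_integral N (fun x => (f x)%:E * M%:E) x =
    \int[leb]_r ((rw r * g r)%:E * M%:E).
  by rewrite -gE; apply: eq_radial => r r0; rewrite /g gtr0_norm.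
have -> : ray_integral N (fun x => phi (N x) * (f x)%:E) x =
    \int[leb]_r ((rw r * g r)%:E * phi r).
  rewrite -gE; apply: eq_radial => r r0.
  by rewrite /g (is_norm_ray N_norm)// gtr0_norm// muleC.
have mg : measurable_fun setT g.
  apply: (measurableT_comp mf); apply: measurable_fun_rVZ.
    by apply: measurable_funM.
  exact: measurable_cst.
have mrw := @measurable_radial_weight R n.
rewrite ge0_integralTZr//; last 2 first.
- by apply/measurable_EFinP; exact: measurable_funM.
- by move=> r; rewrite lee_fin mulr_ge0 ?radial_weight_ge0.
have mrwgphi : measurable_fun setT (fun r => (rw r * g r)%:E * phi r).
  by apply: emeasurable_funM => //; apply/measurable_EFinP; exact: measurable_funM.
have [[r1 r1M]|allM] := pselect (exists r, phi r < M%:E); last first.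
  rewrite -ge0_integralTZr//; last 2 first.
  - by apply/measurable_EFinP; exact: measurable_funM.
  - by move=> r; rewrite lee_fin mulr_ge0 ?radial_weight_ge0.
  apply: ge0_le_integralT => //.
  - apply: emeasurable_funM => //.
    by apply/measurable_EFinP; exact: measurable_funM.
  - by move=> r; rewrite mule_ge0// lee_fin mulr_ge0 ?radial_weight_ge0.
  move=> r; apply: lee_wpmul2l; first by rewrite lee_fin mulr_ge0 ?radial_weight_ge0.
  by rewrite leNgt; apply/negP => rM; apply: allM; exists r.
(* Otherwise the staircase with gamma = 0 would cost at most M, against the strict bound [Mlt]. *)
have phi_geM : exists r, M%:E <= phi r.
  apply: contrapT => nM.
  have := Mlt 0%R; rewrite lexx ler01 => /(_ isT).
  rewrite lt_mean_costE// ltNge => /negP; apply.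
  have mrs0 : measurable_fun setT (fun r => (rw r * rs 0 r)%:E).
    exact: measurable_rw_stair.
  have rs00 r : 0 <= (rw r * rs 0 r)%:E by rewrite lee_fin rw_stair_ge0.
  have <- : \int[leb]_r ((rw r * rs 0 r)%:E * M%:E) = M%:E * Z 0%R.
    by rewrite muleC; exact: ge0_integralTZr.
  apply: ge0_le_integralT.
  - exact: measurable_rw_stair_phi.
  - by apply: emeasurable_funM => //; exact: measurable_rw_stair.
  - by move=> r; exact: rw_stair_phi_ge0.
  move=> r; apply: lee_wpmul2l; first by rewrite lee_fin rw_stair_ge0.
  by rewrite ltW// ltNge; apply/negP => rM; apply: nM; exists r.
apply: (@ge_threshold_ray R epsilon Delta) => //.
- by move=> r; exact: radial_weight_ge0.
- by move=> gamma _; exact: stair_mass_lty.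
- by move=> gamma /Mlt/ltW; rewrite le_mean_costE// muleC.
- by exists r1.
- by move=> r; exact: fgt0.
move=> r r' rr'; apply: fdp; rewrite -scalerBl -mulrBl (is_norm_ray N_norm)//.
by rewrite (le_trans (ler_dist_dist _ _)).
Qed.

End lower_bound.

End staircase_mechanism.

Theorem theorem6 (R : realType) (n : nat) (n_ge1 : (1 <= n)%N)
    (N : 'rV[R]_n -> R) (N_norm : is_norm N)
    (epsilon Delta : R) (epsilon_gt0 : 0 < epsilon) (Delta_gt0 : 0 < Delta)
    (phi : R -> \bar R)
    (phi_ge0 : forall r : R, 0 <= r -> (0 <= phi r)%E)
    (phi_nondecreasing : forall r s : R, 0 <= r -> r <= s -> (phi r <= phi s)%E)
    (Phi : 'rV[R]_n -> \bar R) (PhiE : forall x, Phi x = phi (N x)) :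
  ereal_inf [set (\int[mu]_x Phi x)%E | mu in dp_noise N Delta epsilon] =
  ereal_inf
    [set (\int[lebesgue_rV n]_x
            (Phi x * (staircase_density N Delta epsilon gamma x)%:E))%E
      | gamma in `[0, 1]%classic]
  /\
  exists gamma_star : R,
    [/\ 0 <= gamma_star <= 1,
        ereal_inf
          [set (\int[lebesgue_rV n]_x
                  (Phi x * (staircase_density N Delta epsilon gamma x)%:E))%E
            | gamma in `[0, 1]%classic] =
        (\int[lebesgue_rV n]_x
           (Phi x * (staircase_density N Delta epsilon gamma_star x)%:E))%E &
        exists mu_star : probability 'rV[R]_n R,
          [/\ has_density mu_star (staircase_density N Delta epsilon gamma_star),
              dp_noise N Delta epsilon mu_star &
              (\int[mu_star]_x Phi x)%E =
              ereal_inf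
                [set (\int[mu]_x Phi x)%E | mu in dp_noise N Delta epsilon]]].
Proof.
case: n n_ge1 N N_norm Phi PhiE => // {}n _ N N_norm Phi PhiE.
(* Extending [phi] by phi 0 to negative r makes it monotone on the whole line and leaves its values
   at norms unchanged. *)
pose phi' r := phi (Num.max r 0).
have phi'0 r : (0 <= phi' r)%E by rewrite phi_ge0// le_max lexx orbT.
have phi'_nd r s : r <= s -> (phi' r <= phi' s)%E.
  move=> rs; apply: phi_nondecreasing; first by rewrite le_max lexx orbT.
  by rewrite ge_max !le_max rs lexx !orbT.
have {PhiE}PhiE x : Phi x = phi' (N x).
  by rewrite PhiE /phi' max_l// is_norm_ge0.
have costE gamma : gamma <= 1 ->
    (\int[lebesgue_rV n.+1]_x (Phi x * (staircase_density N Delta epsilon gamma x)%:E) =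
     @mean_cost R n epsilon Delta phi' gamma)%E.
  move=> gamma1; rewrite -(integral_staircase_density N_norm)//.
  by apply: eq_integral => x _; rewrite PhiE.
have [gs /andP[gs0 gs1] gsmin] :=
  exists_min_mean_cost epsilon_gt0 Delta_gt0 phi'0 phi'_nd (n := n).
have infG : ereal_inf
    [set (\int[lebesgue_rV n.+1]_x
      (Phi x * (staircase_density N Delta epsilon gamma x)%:E))%E
      | gamma in `[0, 1]%classic] = @mean_cost R n epsilon Delta phi' gs.
  apply/eqP; rewrite eq_le; apply/andP; split.
    by rewrite -costE//; apply: ereal_inf_lbound; exists gs => //=; rewrite in_itv/= gs0.
  apply: le_ereal_inf_tmp => _ [g /= + <-]; rewrite in_itv/= => g01.
  by rewrite costE; [exact: gsmin|case/andP: g01].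
have md := measurable_staircase_density N_norm epsilon_gt0 Delta_gt0 gs1.
have d0 x := staircase_density_ge0 N_norm epsilon_gt0 Delta_gt0 x gs1.
have d1 : (\int[lebesgue_rV n.+1]_x (staircase_density N Delta epsilon gs x)%:E = 1)%E.
  (* Total mass 1 is the cost formula for the constant function 1. *)
  have := integral_staircase_density N_norm epsilon_gt0 Delta_gt0 (phi := cst 1%E) gs1
    (fun=> lee01) (fun _ _ _ => lexx _).
  under eq_integral do rewrite mul1e.
  move=> ->; rewrite /mean_cost /stair_cost; under eq_integral do rewrite mule1.
  rewrite -[X in (X * _)%E]fineK ?stair_mass_fin_num// -EFinM mulfV//.
  by rewrite gt_eqF// fine_stair_mass_gt0.
have [mu muE] := density_probability md d0 d1.
have mu_density : has_density mu (staircase_density N Delta epsilon gs) by split.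
have mu_dp : dp_noise N Delta epsilon mu.
  split; last first.
    exists (staircase_density N Delta epsilon gs) => // x y xy.
    rewrite !staircase_densityE// mulrCA; apply: ler_wpM2l.
      exact/ltW/staircase_const_gt0.
    exact: le_radial_stair_dp.
  apply/null_content_dominatesP => A mA A0; rewrite muE// null_set_integral//.
  by apply/measurable_EFinP; exact: measurable_funTS.
have mPhi : measurable_fun setT Phi.
  rewrite (_ : Phi = phi' \o N); last by apply/funext => x; exact: PhiE.
  apply: measurableT_comp; first exact: nondecreasing_emeasurable.
  exact: measurable_is_norm.
have muPhi : (\int[mu]_x Phi x = @mean_cost R n epsilon Delta phi' gs)%E.
  rewrite (ge0_integral_density md d0 muE mPhi) ?costE//.
  by move=> x; rewrite PhiE.
have infM : ereal_inf [set (\int[mu]_x Phi x)%E | mu in dp_noise N Delta epsilon] =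
    @mean_cost R n epsilon Delta phi' gs.
  apply/eqP; rewrite eq_le; apply/andP; split.
    by rewrite -muPhi; apply: ereal_inf_lbound; exists mu.
  apply: le_ereal_inf_tmp => _ [nu nu_dp <-].
  have -> : (\int[nu]_x Phi x = \int[nu]_x phi' (N x))%E.
    by apply: eq_integral => x _; exact: PhiE.
  have I0 : (0 <= \int[nu]_x phi' (N x))%E by apply: integral_ge0 => x _.
  (* If [nu] were cheaper, a real M strictly between its cost and the minimal staircase cost, which
     may be infinite, would contradict [dp_noise_ge]. *)
  rewrite leNgt; apply/negP => Ilt.
  have Ifin : (\int[nu]_x phi' (N x))%E \is a fin_num.
    by rewrite ge0_fin_numE// (lt_le_trans Ilt)// leey.
  move: (Ilt); rewrite -{1}(fineK Ifin) => /lte_between[M IM Mlt].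
  have M0 : 0 <= M by rewrite (le_trans _ (ltW IM))// fine_ge0.
  have := dp_noise_ge N_norm epsilon_gt0 Delta_gt0 phi'0 phi'_nd nu_dp M0
    (fun gamma g01 => lt_le_trans Mlt (gsmin gamma g01)).
  by rewrite -(fineK Ifin) lee_fin leNgt IM.
split; first by rewrite infM infG.
exists gs; split; [by rewrite gs0|by rewrite infG costE|].
by exists mu; split => //; rewrite muPhi infM.
Qed.
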